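(* Let $C\ge 2$ be an integer, and let $\alpha$ be a zero-sum-free finite sequence of length $n:=|\alpha|\ge (4C)^3$ over an abelian group. If $|\Sigma(\alpha)|<Cn-C^2\sqrt{6n}$, then there exist an integer $h>n-C\sqrt{6n}$ and an element $a\in\operatorname{supp}(\alpha)$ of order $\operatorname{ord}(a)>h+1$ (possibly infinite order) such that, letting $P:=\{a,2a,\dotsc,ha\}$, we have $$\Sigma(\operatorname{supp}(\alpha))+P\subseteq\Sigma^{\times}(\alpha).$$ Moreover (for these $h$, $a$, $P$), there is a set $X\subseteq\Sigma(\operatorname{supp}(\alpha))$ with $0\in X$ and $|X|\le C-1$ such that $$\Sigma(\operatorname{supp}(\alpha))\subseteq X+P-P;$$ in particular, each term of $\alpha$ can be written as $x+ta$ with an element $x\in X$ and an integer $t\in[-(h-1),h-1]$.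
   Context: A sequence over an abelian group (written additively) is a finite unordered list of group elements with repetitions allowed (a finite multiset). Its length $|\alpha|$ is the number of terms counted with multiplicity. $\operatorname{supp}(\alpha)$ is the set of distinct terms of $\alpha$. For a subsequence (sub-multiset) $\alpha'$ of $\alpha$, $\sigma(\alpha')$ is the sum of all terms of $\alpha'$ with multiplicity ($0$ for the empty subsequence). $\Sigma(\alpha):=\{\sigma(\alpha'):\alpha'\text{ a subsequence of }\alpha\}$ is the set of all subsequence sums including the empty one (so $0\in\Sigma(\alpha)$), and $\Sigma^{\times}(\alpha):=\{\sigma(\alpha'):\alpha'\text{ a nonempty subsequence of }\alpha\}$. A finite set $S$ is regarded as a sequence in which each element has multiplicity $1$, so $\Sigma(S)$ is the set of all sums of subsets of $S$. The sequence $\alpha$ is zero-sum-free if $0\notin\Sigma^{\times}(\alpha)$. For subsets $A,B$ of the group, $A+B=\{a+b: a\in A,b\in B\}$ and $A-B=\{a-b:a\in A,b\in B\}$; thus $X+P-P=\{x+p-p':x\in X,\ p,p'\in P\}$. *)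

(* Defs.v *)
From mathcomp Require Import all_boot all_order all_algebra.
From mathcomp Require Import finmap multiset.
From mathcomp Require Import boolp classical_sets functions cardinality reals.

Set Implicit Arguments.
Unset Strict Implicit.
Unset Printing Implicit Defensive.

Import Order.TTheory GRing.Theory Num.Theory.

Local Open Scope mset_scope.
Local Open Scope classical_set_scope.
Local Open Scope ring_scope.

(* A sequence over G (finite, unordered, repetitions allowed) is a multiset
   alpha : {mset G}; its length is size alpha, its support finsupp alpha. *)

Section SubsequenceSums.
Variable G : zmodType.
Implicit Types (alpha beta : {mset G}) (A B : set G).

Definition sigma alpha : G := \sum_(x <- alpha) x.

Definition Sigma alpha : set G :=
  [set sigma beta | beta in [set beta : {mset G} | (beta `<=` alpha)%mset]].

Definition Sigmax alpha : set G :=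
  [set sigma beta | beta in
    [set beta : {mset G} | (beta `<=` alpha)%mset /\ beta <> mset0]].

Definition zero_sum_free alpha : Prop := ~ Sigmax alpha 0.

(* The support as a sequence in which each term has multiplicity 1. *)
Definition supp_mset alpha : {mset G} := seq_mset (finsupp alpha).

Definition sumset A B : set G := [set x + y | x in A & y in B].
Definition diffset A B : set G := [set x - y | x in A & y in B].

(* None encodes infinite order. *)
Definition ord (a : G) : option nat :=
  if pselect (exists k : nat, (0 < k)%N && (a *+ k == 0)) is left ex
  then Some (ex_minn ex) else None.

Definition ord_gt (o : option nat) (m : nat) : Prop :=
  if o is Some k then (m < k)%N else True.

Definition progression (a : G) (h : nat) : set G :=
  [set a *+ k | k in [set k : nat | (1 <= k <= h)%N]].

(* fset_set is only meaningful on finite sets, so the cardinality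
   #|` fset_set (Sigma alpha)| relies on this fact. *)
Lemma finite_Sigma alpha : finite_set (Sigma alpha).
Proof.
apply: finite_image.
pose F (f : {ffun finsupp alpha -> 'I_(size alpha).+1}) : {mset G} :=
  [fsfun x : finsupp alpha => nat_of_ord (f x)].
apply: (@sub_finite_set _ _ (F @` setT)); last exact: finite_image.
move=> beta /= /forallP le_ba.
have le_b x : (beta x <= alpha x)%N.
  have [xa|] := boolP (x \in finsupp alpha).
    by case: (boolP (x \in finsupp beta)) => [xb|/fsfun_dflt->//];
      exact: le_ba (FSetSub xb).
  case: (boolP (x \in finsupp beta)) => [xb _|/fsfun_dflt->//].
  exact: le_ba (FSetSub xb).
have lt_b x : (beta x < (size alpha).+1)%N.
  by rewrite ltnS (leq_trans (le_b x))// -count_mem_mset count_size.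
exists [ffun x => Ordinal (lt_b (val x))] => //.
apply/msetP => x; rewrite fsfun_ffun.
case: insubP => [u _ <-|xa] /=; first by rewrite ffunE.
by apply/esym/eqP; rewrite -leqn0 (leq_trans (le_b x))// fsfun_dflt.
Qed.

End SubsequenceSums.

(* Main.v *)
Require Import Defs.
From HB Require Import structures.
From mathcomp Require Import all_boot all_order all_algebra.
From mathcomp Require Import finmap multiset.
From mathcomp Require Import boolp classical_sets functions cardinality reals.
From mathcomp Require Import zify ring lra.

Set Implicit Arguments.
Unset Strict Implicit.
Unset Printing Implicit Defensive.

Import Order.TTheory GRing.Theory Num.Theory.
Local Open Scope ring_scope.

(** Write [nz s] for the number of nonzero subsequence sums of a
zero-sum-free list [s], and [n] for its length.

Counting.  For zero-sum-free lists [nz] is superadditive under concatenation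
([nzsums_cat]), by Scherk's theorem on sumsets in which 0 has only its trivial
representation ([scherk]).  Hence every way of cutting the sequence into pieces
bounds [nz] from below.  A zero-sum-free set of [k] elements satisfies
[nz >= (k ^ 2 - 4 k ^ (3/2)) / 6] ([nzsums_quadratic]), by adding its elements
one at a time and choosing at each step the element whose translate of the
current set of sums sticks out most ([olson_growth]).  Cut the sequence into its
first [C] layers, the [i]-th one being the set of the elements of multiplicity
larger than [i], and into the overflow, that is, the copies of each element
beyond the first [C].  The overflow, of length [m], contributes at least [m]
sums, and the layers contribute quadratically; so few sums leave room only for
short layers, namely [m > n - C sqrt (6 n)] ([overflow_bounds]).  Then also
[nz < C m].  The theorem holds with [h = m].

Structure.  Keep one copy of each element of the support apart, since all of
them are used in the sums over the support.  The remaining copies are organised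
in classes.  At first, each element [x] of multiplicity larger than [C] forms a
class with leader [x], made of its overflow; [C - 1] more copies of [x] stay in
reserve.  Suppose that [p x = q a] for leaders [x] and [a], with [p <= C] and
[p <= q], where [q] exceeds the length of the class of [a] by at most 1.  Then [p]
copies of [x] can be traded for [q >= p] copies of [a]: the class of [x] and its
reserve can be merged into the class of [a], and the interval of multiples of [a]
that are sums of the class becomes longer by at least the length of the
absorbed class ([system_merge]).  If no merger is possible, the long
classes have pairwise unrelated leaders, and a class of length [l] put next to
[C] copies of an unrelated leader has at least [(C + 1) l] nonzero sums
([card_subsums_unrelated]).  Two or more long classes arranged in a cycle would
then produce at least [C m] nonzero sums ([nzsums_cycle]), and so would an
absence of long classes ([short_classes_contra]).  So one long class is left, and
it absorbs all short ones ([absorb_short]).  Its leader [a] satisfies: all of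
[0, a, ..., m a] are sums of the terms not kept apart ([system_central]).

Conclusion.  Adding these multiples to the sums over the support gives the first
inclusion, and zero-sum-freeness gives the order of [a], because one more copy of
[a] lies in the support.  For [X], take a maximal set of sums over the support,
containing 0, whose translates of [P] are disjoint ([subprogression_cover]):
disjointness gives [|X| m <= |Sigma(alpha)| < C m], and maximality is
the covering property. *)

(** * Sets of subsequence sums and Scherk's theorem *)

Section Sumsets.
Local Open Scope fset_scope.
Local Open Scope ring_scope.
Variable G : zmodType.
Implicit Types (A B D : {fset G}) (s t u : seq G) (x y : G).

Definition addfs A B : {fset G} := [fset x + y | x in A, y in B].

Lemma addfsP A B z :
  reflect (exists x y, [/\ x \in A, y \in B & z = x + y]) (z \in addfs A B).
Proof.
apply: (iffP idP).
  by case/imfset2P => x /= xA [y /= yB ->]; exists x, y.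
by case=> x [y [xA yB ->]]; apply: in_imfset2.
Qed.

Lemma mem_addfs A B x y : x \in A -> y \in B -> x + y \in addfs A B.
Proof. by move=> xA yB; apply/addfsP; exists x, y. Qed.

Lemma addfsC : commutative addfs.
Proof.
move=> A B; apply/fsetP => z; apply/addfsP/addfsP => -[x [y [xA yB ->]]];
  by exists y, x; rewrite addrC.
Qed.

Lemma addfsA : associative addfs.
Proof.
move=> A B D; apply/fsetP => z; apply/addfsP/addfsP.
  case=> x [_ [xA /addfsP[y [w [yB wD ->]]] ->]].
  by exists (x + y), w; rewrite addrA mem_addfs.
case=> _ [w [/addfsP[x [y [xA yB ->]]] wD ->]].
by exists x, (y + w); rewrite addrA mem_addfs.
Qed.

Lemma add0fs : left_id [fset 0] addfs.
Proof.
move=> A; apply/fsetP => z; apply/addfsP/idP.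
  by case=> x [y [/fset1P -> yA ->]]; rewrite add0r.
by move=> zA; exists 0, z; rewrite add0r inE eqxx.
Qed.

HB.instance Definition _ :=
  Monoid.isComLaw.Build {fset G} [fset 0] addfs addfsA addfsC add0fs.

(** As a sum of the sets [{0, x}] in the commutative monoid of finite sets under
[addfs], the set of subsequence sums is at once invariant under permutations and
additive for concatenation. *)
Definition subsums s : {fset G} := \big[addfs/[fset 0]]_(x <- s) [fset 0; x].

Lemma subsums_nil : subsums [::] = [fset 0].
Proof. by rewrite /subsums big_nil. Qed.

Lemma subsums_cat s t : subsums (s ++ t) = addfs (subsums s) (subsums t).
Proof. by rewrite /subsums big_cat. Qed.

Lemma subsums_perm s t : perm_eq s t -> subsums s = subsums t.
Proof. by move=> st; apply: perm_big. Qed.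

Lemma subsums_consE x s y :
  (y \in subsums (x :: s)) = (y \in subsums s) || (y - x \in subsums s).
Proof.
rewrite /subsums big_cons; apply/addfsP/orP.
  case=> a [b [/fset2P[]-> bs ->]]; first by left; rewrite add0r.
  by right; rewrite addrAC subrr add0r.
case=> ys; first by exists 0, y; rewrite !inE eqxx add0r.
by exists x, (y - x); rewrite !inE eqxx orbT [x + _]addrC subrK.
Qed.

Lemma subsums0 s : 0 \in subsums s.
Proof.
by elim: s => [|x s IH]; rewrite ?subsums_nil ?inE // subsums_consE IH.
Qed.

Lemma subsums_sub t u : {subset subsums t <= subsums (t ++ u)}.
Proof.
by move=> x xt; rewrite subsums_cat -[x]addr0 mem_addfs // subsums0.
Qed.

Lemma subsums_subr t u : {subset subsums u <= subsums (t ++ u)}.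
Proof.
by move=> x xt; rewrite subsums_cat -[x]add0r mem_addfs // subsums0.
Qed.

Lemma subsumsP s y :
  reflect (exists t u, perm_eq s (t ++ u) /\ y = \sum_(x <- t) x)
          (y \in subsums s).
Proof.
apply: (iffP idP); last first.
  case=> t [u [/subsums_perm -> ->]]; apply: subsums_sub.
  elim: t => [|x t IH]; first by rewrite big_nil subsums0.
  by rewrite big_cons subsums_consE addrAC subrr add0r IH orbT.
elim: s y => [|x s IH] y.
  by rewrite subsums_nil inE => /eqP ->; exists [::], [::]; rewrite big_nil.
rewrite subsums_consE => /orP[] /IH[t [u [stu yE]]].
  by exists t, (x :: u); split; rewrite // perm_sym -cat1s perm_catCA perm_cons perm_sym.
exists (x :: t), u; split; first by rewrite perm_cons.
by rewrite big_cons -yE addrC subrK.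
Qed.

Definition zsf s := forall t u, perm_eq s (t ++ u) -> t != [::] ->
  \sum_(x <- t) x != 0.

Lemma zsf_perm s t : perm_eq s t -> zsf s -> zsf t.
Proof. by move=> st zs t1 u tu; apply: (zs _ u); apply: perm_trans tu. Qed.

Lemma zsf_catl s t : zsf (s ++ t) -> zsf s.
Proof.
move=> z t1 u st; apply: (z _ (u ++ t)).
by rewrite catA perm_cat2r.
Qed.

Lemma zsf_catr s t : zsf (s ++ t) -> zsf t.
Proof. by move=> z; apply: (@zsf_catl _ s); apply: zsf_perm z; rewrite perm_catC. Qed.

Lemma zsf_sub s t u : perm_eq s (t ++ u) -> zsf s -> zsf t.
Proof. by move=> p /(zsf_perm p)/zsf_catl. Qed.

Lemma zsf_cons x s y : zsf (x :: s) -> y \in subsums s -> x + y != 0.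
Proof.
move=> z /subsumsP[t [u [stu ->]]]; have := z (x :: t) u.
by rewrite big_cons; apply=> //; rewrite perm_cons.
Qed.

Lemma zsf_cat s t x y : zsf (s ++ t) -> x \in subsums s -> y \in subsums t ->
  x + y = 0 -> x = 0 /\ y = 0.
Proof.
move=> z /subsumsP[t1 [u1 [s1 ->]]] /subsumsP[t2 [u2 [s2 ->]]] e.
have [/eqP|ne] := eqVneq (t1 ++ t2) [::]; last first.
  have := z (t1 ++ t2) (u1 ++ u2) _ ne; rewrite big_cat /= e eqxx; case/(_ _)/negP => //.
  rewrite (perm_trans (perm_cat s1 s2)) // -!catA perm_cat2l !catA perm_cat2r.
  by rewrite perm_catC.
by rewrite -size_eq0 size_cat addn_eq0 !size_eq0 => /andP[/eqP-> /eqP->]; rewrite big_nil.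
Qed.

Lemma card_addr (e : G) B : #|` [fset x + e | x in B]| = #|` B|.
Proof. by apply: card_imfset => x y /=; apply: addIr. Qed.

(** Dyson's transform: as long as some [b + e] with [b] in [B] and [e] in [A] lies
outside [A], replace [A] by its union with [B + e] and [B] by its intersection
with [A - e].  The total size is unchanged, the sumset does not grow, [B] gets
smaller, and 0 keeps its unique representation.  When no such pair is left,
[A + b = A] for each [b] in [B], so that 0 lies in [A + b], whence [b = 0]. *)
Lemma scherk A B : 0 \in A -> 0 \in B ->
  (forall x y, x \in A -> y \in B -> x + y = 0 -> x = 0 /\ y = 0) ->
  (#|` A| + #|` B| <= #|` addfs A B| + 1)%N.
Proof.
have [n] := ubnP #|` B|; elim: n A B => // n IH A B; rewrite ltnS => leB A0 B0 u.
have [/existsP[e /existsP[b]]|none] := boolP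
    [exists e : A, exists b : B, val b + val e \notin A].
  move: (valP e) (valP b); move: (val e) (val b) => {}e {}b eA bB beA.
  pose A' := A `|` [fset x + e | x in B].
  pose B' := [fset x in B | x + e \in A].
  have cards : (#|` A'| + #|` B'| = #|` A| + #|` B|)%N.
    have := cardfsUI A [fset x + e | x in B]; rewrite card_addr => <-; congr (_ + _)%N.
    rewrite -(card_addr e); congr #|` _|; apply/fsetP => z.
    apply/imfsetP/idP => /=.
      case=> x; rewrite !inE /= => /andP[xB xeA] ->; rewrite xeA.
      by apply/imfsetP; exists x.
    rewrite inE => /andP[zA /imfsetP[x /= xB zE]]; exists x => //.
    by rewrite !inE xB -zE.
  have subAB : addfs A' B' `<=` addfs A B.
    apply/fsubsetP => z /addfsP[x [y [xA']]]; rewrite !inE /= => /andP[yB yeA] ->.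
    move: xA'; rewrite inE => /orP[xA|/imfsetP[w /= wB ->]]; first exact: mem_addfs.
    by rewrite -addrA addrC [e + y]addrC mem_addfs.
  rewrite -cards; apply: leq_trans (IH A' B' _ _ _ _) _.
  - apply: leq_trans leB; apply: fproper_ltn_card; rewrite fproperE; apply/andP; split.
      by apply/fsubsetP => x; rewrite !inE => /andP[].
    by apply/fsubsetPn; exists b => //; rewrite !inE /= bB (negbTE beA).
  - by rewrite inE A0.
  - by rewrite !inE B0 add0r eA.
  - move=> x y xA'; rewrite !inE /= => /andP[yB yeA] xy0.
    move: xA' xy0; rewrite inE => /orP[xA|/imfsetP[w /= wB ->]]; first exact: u.
    move=> e0; have [ye0 w0] : y + e = 0 /\ w = 0.
      by apply: u => //; rewrite addrC [y + e]addrC addrA.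
    have [-> ->] : e = 0 /\ y = 0 by apply: u => //; rewrite addrC.
    by rewrite w0 addr0.
  - by rewrite leq_add2r; apply: fsubset_leq_card.
have inA e b : e \in A -> b \in B -> b + e \in A.
  move=> eA bB; move/existsPn/(_ [` eA])/existsPn/(_ [` bB]): none => /=.
  by rewrite negbK.
have B1 b : b \in B -> b = 0.
  move=> bB; have sAA : [fset x + b | x in A] `<=` A.
    by apply/fsubsetP => _ /imfsetP[x /= xA ->]; rewrite addrC inA.
  have : 0 \in [fset x + b | x in A].
    by have /fsubset_cardP/(_ sAA)-> := card_addr b A.
  case/imfsetP => x /= xA /esym x0.
  by have [] := u _ _ xA bB x0.
have -> : B = [fset 0].
  apply/fsetP => b; rewrite inE; apply/idP/eqP => [/B1//|->//].
by rewrite addfsC add0fs cardfs1.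
Qed.

(** Discounting the empty sum turns the bound of [scherk] into superadditivity. *)
Definition nzsums s := (#|` subsums s|).-1.

Lemma subsums_card s : #|` subsums s| = (nzsums s).+1.
Proof. by rewrite prednK // cardfs_gt0; apply/fset0Pn; exists 0; apply: subsums0. Qed.

Lemma nzsums_perm s t : perm_eq s t -> nzsums s = nzsums t.
Proof. by move=> /subsums_perm st; rewrite /nzsums st. Qed.

Lemma nzsums_cat s t : zsf (s ++ t) -> (nzsums s + nzsums t <= nzsums (s ++ t))%N.
Proof.
move=> z; have := @scherk (subsums s) (subsums t) (subsums0 _) (subsums0 _).
rewrite -subsums_cat !subsums_card => /(_ _); rewrite !addn1 !addSn addnS !ltnS.
apply=> x y; exact: zsf_cat.
Qed.

Lemma nzsums_sub s t u : perm_eq s (t ++ u) -> zsf s -> (nzsums t <= nzsums s)%N.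
Proof.
move=> p z; rewrite (nzsums_perm p); apply: leq_trans (nzsums_cat (zsf_perm p z)).
exact: leq_addr.
Qed.

Lemma nzsums_flatten (ls : seq (seq G)) : zsf (flatten ls) ->
  (\sum_(l <- ls) nzsums l <= nzsums (flatten ls))%N.
Proof.
elim: ls => [|l ls IH] /= z; first by rewrite big_nil.
rewrite big_cons; apply: leq_trans (nzsums_cat z); rewrite leq_add2l.
by apply: IH; apply: zsf_catr z.
Qed.

Lemma nzsums1 x : zsf [:: x] -> nzsums [:: x] = 1%N.
Proof.
move=> z; have x0 : x != 0 by have := zsf_cons z (subsums0 [::]); rewrite addr0.
rewrite /nzsums /subsums big_seq1 cardfs2 eq_sym x0 //.
Qed.

Lemma nzsums_size s : zsf s -> (size s <= nzsums s)%N.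
Proof.
move=> z; have -> : s = flatten [seq [:: x] | x <- s].
  by elim: {z} s => //= x s {1}->.
apply: leq_trans (nzsums_flatten _); last first.
  by have -> : flatten [seq [:: x] | x <- s] = s by elim: {z} s => //= x s ->.
have -> : flatten [seq [:: x] | x <- s] = s by elim: {z} s => //= x s ->.
rewrite big_map -sum1_size big_seq [X in (_ <= X)%N]big_seq; apply: leq_sum => x xs.
by rewrite nzsums1 //; apply: (zsf_sub (u := rem x s)) z; rewrite perm_to_rem.
Qed.

End Sumsets.

(** * Growth of a set of sums under one more translate *)

Section Growth.
Local Open Scope fset_scope.
Local Open Scope ring_scope.
Variable G : zmodType.
Implicit Types (A K : {fset G}) (B E : seq G) (x y z : G).

Definition shift A x : {fset G} := [fset y + x | y in A].
Definition growth A x := #|` shift A x `\` A|.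

Lemma in_shift A x z : (z \in shift A x) = (z - x \in A).
Proof.
apply/imfsetP/idP => [[y /= yA ->]|zA]; first by rewrite addrK.
by exists (z - x); rewrite // subrK.
Qed.

Lemma card_shift A x : #|` shift A x| = #|` A|.
Proof. exact: card_addr. Qed.

Lemma growthI A x : (#|` [fset z in A | (z - x)%R \in A]| + growth A x = #|` A|)%N.
Proof.
rewrite -(card_shift A x) -(cardfsID A (shift A x)); congr (#|` _| + _)%N.
by apply/fsetP => z; rewrite !inE /= in_shift andbC.
Qed.

Lemma growth0 A : growth A 0 = 0%N.
Proof.
apply/eqP; rewrite cardfs_eq0; apply/eqP/fsetP => z.
by rewrite !inE in_shift subr0 andNb.
Qed.

Lemma growthN A x : growth A (- x) = growth A x.
Proof.
apply: (@addnI #|` [fset z in A | (z - x)%R \in A]|); rewrite growthI.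
rewrite -(growthI A (- x)); congr (_ + _)%N.
rewrite -(card_shift _ (- x)); congr #|` _|; apply/fsetP => z.
by rewrite in_shift !inE /= opprK addrK andbC.
Qed.

Lemma growthD A x y : (growth A (x + y) <= growth A x + growth A y)%N.
Proof.
rewrite /growth -(card_shift (shift A x `\` A) y) addnC.
rewrite -cardfsUI; apply: leq_trans (leq_addr _ _); apply: fsubset_leq_card.
apply/fsubsetP => z; rewrite !inE !in_shift !inE !in_shift => /andP[-> /=].
by rewrite opprD addrA addrAC => ->; rewrite andbT orbN.
Qed.

Lemma card_sep A (P : pred G) :
  #|` [fset z in A | P z]| = (\sum_(z <- A) P z)%N.
Proof.
have -> : (\sum_(z <- A) P z)%N = count P A.
  by elim: (enum_fset A) => [|z s IH]; rewrite ?big_nil ?big_cons //= IH.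
rewrite -size_filter; apply/perm_size/uniq_perm.
- exact: fset_uniq.
- by rewrite filter_uniq ?fset_uniq.
by move=> z; rewrite mem_filter !inE /= andbC.
Qed.

(** Averaging: for fixed [z] in [A], the elements [x] of [E] with [z - x] in [A] are
at most [#|A|] many, so the overlaps of [A] with its translates by [E] add up to at most
[#|A| ^ 2]. *)
Lemma sum_growth A E : uniq E ->
  (size E * #|` A| <= #|` A| ^ 2 + \sum_(x <- E) growth A x)%N.
Proof.
move=> uE; rewrite -sum1_size big_distrl /=.
have -> : (\sum_(x <- E) 1 * #|` A| =
    \sum_(x <- E) \sum_(z <- A) ((z - x)%R \in A) + \sum_(x <- E) growth A x)%N.
  rewrite -big_split /=; apply: eq_bigr => x _; rewrite mul1n -(growthI A x).
  by rewrite card_sep.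
rewrite leq_add2r exchange_big /= -mulnn -{1}[#|` A|]sum1_size big_distrl /=.
rewrite big_seq [X in (_ <= X)%N]big_seq; apply: leq_sum => z zA; rewrite mul1n.
rewrite -big_mkcond /= sum1_count -size_filter -(size_map (fun x => z - x)).
apply: uniq_leq_size.
  by rewrite map_inj_uniq ?filter_uniq // => x y /= /addrI/oppr_inj.
by move=> w /mapP[x]; rewrite mem_filter => /andP[xA _] ->.
Qed.

Lemma seq_argmax (T : eqType) (F : T -> nat) (s : seq T) : s != [::] ->
  exists2 x : T, x \in s & forall y : T, y \in s -> (F y <= F x)%N.
Proof.
elim: s => // x [|x' s] IH _.
  by exists x; rewrite ?inE // => y; rewrite inE => /eqP ->.
have [y ys max_y] := IH isT.
have [le_xy|lt_yx] := leqP (F x) (F y).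
  exists y; first by rewrite inE ys orbT.
  by move=> z; rewrite inE => /predU1P[->//|/max_y].
exists x; first by rewrite inE eqxx.
move=> z; rewrite inE => /predU1P[->//|/max_y zy].
exact: leq_trans zy (ltnW lt_yx).
Qed.

Section Star.
Variable B : seq G.
Hypothesis uB : uniq B.
Hypothesis NB : forall x, x \in B -> - x \notin B.

Definition star : seq G := 0 :: B ++ map -%R B.

Lemma uniq_star : uniq star.
Proof.
have B0 : 0 \notin B by apply/negP => /[dup] /NB; rewrite oppr0 => /negP.
rewrite /= mem_cat negb_or B0 cat_uniq uB (map_inj_uniq (@oppr_inj G)) uB andbT /=.
apply/andP; split.
  by apply: contra B0 => /mapP[x xB /esym/eqP]; rewrite oppr_eq0 => /eqP <-.
by apply/hasPn => _ /mapP[x xB ->]; apply: NB.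
Qed.

Lemma size_star : size star = (2 * size B).+1.
Proof. by rewrite /= size_cat size_map addnn mul2n. Qed.

Lemma starN x : x \in star -> - x \in star.
Proof.
rewrite !inE !mem_cat oppr_eq0 => /orP[->//|/orP[xB|/mapP[y yB ->]]].
  by rewrite (map_f _ xB) !orbT.
by rewrite opprK yB orbT.
Qed.

Lemma growth_star A m : (forall x, x \in B -> (growth A x <= m)%N) ->
  forall x, x \in star -> (growth A x <= m)%N.
Proof.
move=> Bm x; rewrite inE mem_cat => /predU1P[->|/orP[/Bm//|/mapP[y /Bm ym ->]]].
  by rewrite growth0.
by rewrite growthN.
Qed.

(** Balls around 0 of the Cayley graph of the group with respect to [B]. *)
Fixpoint ball k : {fset G} :=
  if k is k'.+1 then addfs [fset x in star] (ball k') else [fset 0].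

Lemma star_ball : [fset x in star] = ball 1.
Proof. by rewrite /= addfsC add0fs. Qed.

Lemma ballD k l : addfs (ball k) (ball l) = ball (k + l).
Proof.
elim: k => [|k IH]; first by rewrite add0fs.
by rewrite addSn [LHS]/= -addfsA IH.
Qed.

Lemma ball0 k : 0 \in ball k.
Proof.
elim: k => [|k IH]; first by rewrite inE.
by rewrite -[0]addr0; apply: (@mem_addfs _ [fset x in star]) => //; rewrite !inE eqxx.
Qed.

Lemma ballS k : ball k `<=` ball k.+1.
Proof.
apply/fsubsetP => x xk; rewrite -[x]add0r; apply: (@mem_addfs _ [fset x in star]) => //.
by rewrite !inE eqxx.
Qed.

Lemma ball_mono k l : (k <= l)%N -> ball k `<=` ball l.
Proof.
move=> /subnK <-; elim: (l - k)%N => // i IH.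
by apply: fsubset_trans IH _; apply: ballS.
Qed.

Lemma ballN k x : x \in ball k -> - x \in ball k.
Proof.
elim: k x => [|k IH] x; first by rewrite !inE oppr_eq0.
case/addfsP => y [z [yB zB ->]]; rewrite opprD mem_addfs ?IH //.
by move: yB; rewrite !in_fset; apply: starN.
Qed.

Lemma growth_ball A m : (forall x, x \in B -> (growth A x <= m)%N) ->
  forall k x, x \in ball k -> (growth A x <= k * m)%N.
Proof.
move=> /growth_star sm; elim=> [|k IH] x; first by rewrite inE => /eqP ->; rewrite growth0.
case/addfsP => y [z [yB zB ->]]; rewrite mulSn.
apply: leq_trans (growthD _ _ _) (leq_add _ (IH _ zB)).
by apply: sm; move: yB; rewrite in_fset.
Qed.

Lemma card_ball1 : #|` ball 1| = (2 * size B).+1.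
Proof. by rewrite -star_ball card_fseq undup_id ?uniq_star // size_star. Qed.

(** Place disjoint unit balls around points at distances 0, 3, 6, and so on: as long
as the balls keep growing, such points exist, and each unit ball has
[2 * size B + 1] points. *)
Lemma ball_packing i : (forall j, (j < 3 * i)%N -> ball j != ball j.+1) ->
  (i.+1 * (2 * size B).+1 <= #|` ball (3 * i).+1|)%N.
Proof.
elim: i => [|i IH] neq; first by rewrite mul1n muln0 card_ball1.
have {}IH := IH (fun j lt_j => neq j (leq_trans lt_j (leq_mul (leqnn 3) (leqnSn i)))).
have [z zS zN] : exists2 z, z \in ball (3 * i).+3 & z \notin ball (3 * i).+2.
  have := neq (3 * i).+2; rewrite mulnS !addSn add0n => /(_ (leqnn _)).
  by rewrite eqEfsubset ballS /= => /fsubsetPn.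
rewrite mulSn addnC; apply: leq_trans (leq_add IH (leqnn _)) _.
rewrite -card_ball1 -(card_shift (ball 1) z).
have dis : ball (3 * i).+1 `&` shift (ball 1) z = fset0.
  apply/eqP; apply: contraR zN => /fset0Pn[x]; rewrite inE in_shift => /andP[xi xz].
  rewrite -[z](subKr x) addrC -[(3 * i).+2]add1n -ballD mem_addfs //.
  exact: (@ballN 1).
rewrite -cardfsUI dis cardfs0 addn0; apply: fsubset_leq_card.
rewrite fsubUset; apply/andP; split; first by apply: ball_mono; lia.
apply/fsubsetP => x; rewrite in_shift => xz; rewrite -(subrK z x).
have -> : (3 * i.+1).+1 = (1 + (3 * i).+3)%N by lia.
by rewrite -ballD mem_addfs.
Qed.

(** Distance to 0, truncated at [k]: the number of radii below [k] whose ball misses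
the point.  This form makes sums of distances computable by exchanging sums. *)
Definition dist k x := (\sum_(j < k) (x \notin ball j))%N.

Lemma dist_ball k x : x \in ball k -> x \in ball (dist k x).
Proof.
elim: k => [|k IH] xk; first by rewrite /dist big_ord0.
have [/IH xk'|xk'] := boolP (x \in ball k).
  rewrite /dist big_ord_recr /= (_ : _ \notin _ = false) ?addn0 //.
  apply: negbTE; rewrite negbK; apply: (fsubsetP (ball_mono _) _ xk').
  by rewrite -[leqRHS]card_ord -sum1_card; apply: leq_sum => i _; apply: leq_b1.
suff -> : dist k.+1 x = k.+1 by [].
rewrite /dist (eq_bigr (fun=> 1%N)) ?sum1_card ?card_ord // => i _.
case: (boolP (x \in ball i)) => // xi; case/negP: xk'.
by apply: (fsubsetP (ball_mono _) _ xi); rewrite -ltnS.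
Qed.

(** Growth is subadditive, so it is at most [m] times the distance to 0. *)
Lemma sum_growth_ball A m k (E : seq G) :
    (forall x, x \in B -> (growth A x <= m)%N) -> uniq E ->
    (forall x, x \in E -> x \in ball k) ->
    (forall j, (j < k)%N -> forall x, x \in ball j -> x \in E) ->
  (\sum_(x <- E) growth A x <= m * \sum_(j < k) (size E - #|` ball j|))%N.
Proof.
move=> Bm uE Ek kE.
have -> : (\sum_(j < k) (size E - #|` ball j|) = \sum_(x <- E) dist k x)%N.
  rewrite exchange_big /=; apply: eq_bigr => j _.
  rewrite -(count_predC (mem (ball j)) E) /=.
  have -> : count (mem (ball j)) E = #|` ball j|.
    rewrite -size_filter; apply/perm_size/uniq_perm; rewrite ?filter_uniq ?fset_uniq //.
    move=> x; rewrite mem_filter /=; case: (boolP (x \in ball j)) => // xj.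
    exact: kE xj.
  by rewrite addKn; elim: (E) => [|x E' IH]; rewrite ?big_nil ?big_cons //= IH.
rewrite big_distrr /= big_seq [X in (_ <= X)%N]big_seq; apply: leq_sum => x xE.
by rewrite mulnC; apply: growth_ball => //; apply/dist_ball/Ek.
Qed.

End Star.

(** For real [N], the sum of the terms [y - i t] with [1 <= i <= N] is a quadratic
function of [N] with maximum [(2 y - t) ^ 2 / (8 t)]. *)
Lemma sum_steps (t y N : nat) :
  (8 * t * \sum_(i < N) (y - i.+1 * t) + 4 * t * y <= 4 * y * y + t * t)%N.
Proof.
have base (z : nat) : (4 * t * z <= 4 * z * z + t * t)%N.
  have [le|/ltnW le] := leqP (2 * z) t.
    by rewrite -(subnKC le); move: (t - _)%N => d; nia.
  have := subnKC le; move: (_ - t)%N => d e.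
  by have := congr1 (fun i : nat => i * i)%N e; nia.
elim: N y => [|N IH] y; first by rewrite big_ord0 muln0; apply: base.
rewrite big_ord_recl mul1n.
have [lt_yt|le_ty] := ltnP y t.
  rewrite (_ : (y - t)%N = 0%N) ?add0n; last by lia.
  rewrite big1 ?muln0; first by apply: base.
  move=> i _; apply/eqP; rewrite subn_eq0 /bump /=.
  by rewrite mulSn; lia.
have := IH (y - t)%N.
rewrite [in X in _ -> X](eq_bigr (fun i : 'I_N => y - t - i.+1 * t)%N); last first.
  by move=> i _; rewrite /bump /= -subnDA -mulSn.
rewrite mulnDr; move: (\sum_(i < N) _)%N => S; have := subnK le_ty.
by move: (y - t)%N => z <-; nia.
Qed.

Lemma sum_thirds (h : nat -> nat) k :
  (\sum_(j < 3 * k) h (j %/ 3) = 3 * \sum_(i < k) h i)%N.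
Proof.
elim: k => [|k IH]; first by rewrite !big_ord0.
have e d : (d < 3)%N -> ((3 * k + d) %/ 3 = k)%N.
  by move=> lt_d; rewrite mulnC divnMDl // divn_small // addn0.
rewrite [in RHS]big_ord_recr /= mulnDr -IH mulnS addnC !addnS addn0 !big_ord_recr /=.
have := (e 0 isT, e 1 isT, e 2 isT)%N; rewrite addn0 addn1 addn2 => -[[-> ->] ->].
by rewrite mulSn; lia.
Qed.

Definition subgroup K := [/\ 0 \in K, forall x y, x \in K -> y \in K -> x + y \in K
  & forall x, x \in K -> - x \in K].

(** A large growth among the elements of [B], by averaging it over two sets.  Over
the star of [B], all elements but 0 are in [B] up to sign: this is the
first bound.  For the second one, average over a set [E] of [2 * #|A|] points as
close to 0 as possible.  Growth adds up to at least [#|A| ^ 2] there, whereas it is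
at most the maximal growth on [B] times the distance to 0, and distances are small
because balls gain [2 * size B + 1] points every three steps.  This fails only if
the balls stop growing before they reach [2 * #|A|] points; the stable ball
is then a subgroup. *)
Lemma olson_growth A B : (0 < #|` A|)%N -> B != [::] -> uniq B ->
    (forall x, x \in B -> - x \notin B) ->
  (exists K, [/\ subgroup K, {subset B <= K} & (#|` K| < 2 * #|` A|)%N]) \/
  exists2 x, x \in B &
    (#|` A| * (2 * size B).+1 <= #|` A| ^ 2 + 2 * size B * growth A x)%N /\
    ((2 * size B < 2 * #|` A|)%N -> (2 * size B < 6 * growth A x)%N).
Proof.
move=> A_gt0 B0 uB NB; set a := #|` A|; set t := (2 * size B).+1.
have [x xB max_x] := seq_argmax (growth A) B0.
have part1 : (a * t <= a ^ 2 + 2 * size B * growth A x)%N.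
  rewrite mulnC /t -(size_star B); apply: leq_trans (sum_growth A (uniq_star uB NB)) _.
  rewrite leq_add2l /star big_cons growth0 add0n big_cat big_map /=.
  under [X in (_ + X <= _)%N]eq_bigr do rewrite growthN.
  rewrite addnn -mul2n -mulnA leq_mul2l /= -sum1_size big_distrl /=.
  by rewrite big_seq [leqRHS]big_seq; apply: leq_sum => y yB; rewrite mul1n max_x.
have [[k [kk k_small]]|nostable] :=
    pselect (exists k, ball B k = ball B k.+1 /\ (#|` ball B k| < 2 * a)%N).
  left; exists (ball B k); split=> //.
    split; first exact: ball0.
      have stab i : ball B (k + i) = ball B k.
        elim: i => [|i IH]; first by rewrite addn0.
        by rewrite addnS [RHS]kk /= IH.
      by move=> y z yk zk; rewrite -(stab k) -ballD mem_addfs.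
    exact: ballN.
  move=> y yB; rewrite kk -add1n -ballD -[y]addr0 mem_addfs ?ball0 //.
  by rewrite -star_ball in_fset in_cons mem_cat yB orbT.
right; exists x => //; split=> // ta; rewrite -/t -ltnS in ta *.
have neq k : (#|` ball B k| < 2 * a)%N -> ball B k != ball B k.+1.
  by move=> small; apply/eqP => kk; apply: nostable; exists k.
have exk : exists k, (2 * a <= #|` ball B k|)%N.
  apply: contrapT => nok.
  have small k : (#|` ball B k| < 2 * a)%N.
    by rewrite ltnNge; apply/negP => le; apply: nok; exists k.
  have : (2 * a <= #|` ball B (2 * a)|)%N.
    elim: (2 * a)%N => // i IH; apply: leq_ltn_trans IH _; apply: fproper_ltn_card.
    by rewrite fproperEneq neq //= ballS.
  by rewrite leqNgt small.
case: (ex_minnP exk) => -[|k]; first by rewrite cardfs1; lia.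
move=> le_ak min_k {exk}.
have small j : (j <= k)%N -> (#|` ball B j| < 2 * a)%N.
  by move=> le_jk; rewrite ltnNge; apply/negP => /min_k; lia.
(* the 2 * #|A| points closest to 0: a full ball and a part of the next sphere *)
pose E := enum_fset (ball B k) ++
  take (2 * a - #|` ball B k|) (enum_fset (ball B k.+1 `\` ball B k)).
have sizeE : size E = (2 * a)%N.
  have le_k : (#|` ball B k| <= 2 * a)%N by apply/ltnW/small.
  rewrite size_cat size_takel; first by rewrite subnKC.
  rewrite leq_subLR; apply: leq_trans le_ak _.
  rewrite -[leqLHS](cardfsID (ball B k)) leq_add2r.
  by apply: fsubset_leq_card; apply: fsubsetIr.
have uE : uniq E.
  rewrite cat_uniq fset_uniq take_uniq ?fset_uniq // andbT.
  by apply/hasPn => y /mem_take; rewrite inE => /andP[].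
have := sum_growth_ball max_x uE (k := k.+1); rewrite sizeE => /(_ _ _)/wrap[].
- move=> y; rewrite mem_cat => /orP[|/mem_take]; last by rewrite inE => /andP[].
  by apply/fsubsetP/ballS.
- move=> j lt_jk y yj; rewrite mem_cat; apply/orP; left.
  by move: yj; apply/fsubsetP/ball_mono.
move=> le1; have := sum_growth A uE; rewrite sizeE -/a => le2.
have le3 : (\sum_(j < k.+1) (2 * a - #|` ball B j|) <=
    (2 * a - 1) + 3 * \sum_(i < k) (2 * a - i.+1 * t))%N.
  rewrite big_ord_recl cardfs1 leq_add2l.
  rewrite -(sum_thirds (fun i => 2 * a - i.+1 * t)%N).
  have -> : (3 * k = k + (2 * k))%N by lia.
  rewrite big_split_ord /=; apply: leq_trans (leq_addr _ _); apply: leq_sum => j _.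
  apply: leq_sub2l; apply: leq_trans (@ball_packing B uB NB (j %/ 3) _) _.
    move=> i lt_i; apply: neq; apply: small; have := leq_divM j 3; have := ltn_ord j; lia.
  apply: fsubset_leq_card; apply: (@ball_mono B _ j.+1).
  by have := leq_divM j 3; lia.
have le4 := sum_steps t (2 * a) k.
move: le1 le2 le3 le4; move: (\sum_(j < k.+1) _)%N (\sum_(i < k) _)%N (\sum_(x <- E) _)%N.
rewrite expnS expn1 => S1 S2 S3 le1 le2 le3 le4.
have le5 : (a * a <= growth A x * S1)%N by lia.
have le6 : (t * S1 <= 6 * (a * a))%N by nia.
have : (t * (a * a) <= 6 * growth A x * (a * a))%N by nia.
by rewrite leq_pmul2r // muln_gt0 A_gt0.
Qed.

End Growth.

(** * Sums modulo a small subgroup *)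

Section Restart.
Local Open Scope fset_scope.
Local Open Scope ring_scope.
Variable G : zmodType.
Implicit Types (A K : {fset G}) (B U S : seq G) (x y z : G).

Lemma subsums_subgroup K B : subgroup K -> {subset B <= K} ->
  {subset subsums B <= K}.
Proof.
case=> K0 KD KN; elim: B => [|b B IH] sB x.
  by rewrite subsums_nil inE => /eqP ->.
have {}IH : {subset subsums B <= K} by apply: IH => y yB; apply: sB; rewrite inE yB orbT.
rewrite subsums_consE => /orP[/IH//|/IH xbK].
by rewrite -(subrK b x) KD // sB ?mem_head.
Qed.

(** If all sums of [U] lie in [K], they are disjoint there from the opposites of the
nonzero sums of [B], which bounds [nzsums B] by [nzsums U].  Otherwise a
sum of [U] outside [K] moves the sums of [B] to another coset, where they form a
second copy. *)
Lemma nzsums_subgroup K U B : zsf (U ++ B) -> subgroup K -> {subset B <= K} ->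
  (#|` K| < 2 * #|` subsums U|)%N -> (2 * nzsums B <= nzsums (U ++ B))%N.
Proof.
move=> z gK sBK ltK; have sB := subsums_subgroup gK sBK; case: gK => K0 KD KN.
have [sUK|/fsubsetPn[u uU uK]] := boolP (subsums U `<=` K).
  pose N := [fset - y | y in subsums B `\ 0].
  have cardN : #|` N| = nzsums B.
    rewrite card_imfset /=; last exact: oppr_inj.
    by have := cardfsD1 0 (subsums B); rewrite subsums0 subsums_card => -[].
  have dis : subsums U `&` N = fset0.
    apply/eqP; apply: contraT => /fset0Pn[x]; rewrite inE => /andP[xU /imfsetP[y /=]].
    rewrite !inE => /andP[y0 yB] xE; move: y0.
    by have [] := zsf_cat z xU yB; rewrite ?xE ?addNr // => _ ->; rewrite eqxx.
  have le : (#|` subsums U| + nzsums B <= #|` K|)%N.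
    rewrite -cardN -cardfsUI dis cardfs0 addn0; apply: fsubset_leq_card.
    rewrite fsubUset sUK; apply/fsubsetP => _ /imfsetP[y /= yB ->].
    by apply/KN/sB; move: yB; rewrite !inE => /andP[].
  by have := nzsums_cat z; have := subsums_card U; lia.
have : (#|` subsums B `|` shift (subsums B) u| <= #|` subsums (U ++ B)|)%N.
  apply: fsubset_leq_card; rewrite fsubUset; apply/andP; split; apply/fsubsetP => x.
    exact: subsums_subr.
  by rewrite in_shift => xu; rewrite subsums_cat -(subrK u x) addrC mem_addfs.
have dis : subsums B `&` shift (subsums B) u = fset0.
  apply/eqP; apply: contraR uK => /fset0Pn[x]; rewrite inE in_shift => /andP[/sB xK /sB xuK].
  by rewrite -(subKr x u) KD // KN.
have := cardfsUI (subsums B) (shift (subsums B) u).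
by rewrite dis cardfs0 card_shift !subsums_card; lia.
Qed.

Lemma nzsums_pair x y : zsf [:: x; y] -> x != y -> (3 <= nzsums [:: x; y])%N.
Proof.
move=> z xy; rewrite -ltnS -subsums_card.
have x0 : x != 0 by have := zsf_cons z (subsums0 _); rewrite addr0.
have y0 : y != 0.
  by have := zsf_cons (zsf_catr (s := [:: x]) z) (subsums0 _); rewrite addr0.
have xy0 : x + y != 0.
  by apply: (zsf_cons z); rewrite subsums_consE subrr subsums0 orbT.
have u : uniq [:: 0; x; y; x + y].
  rewrite /= !inE !negb_or eq_sym x0 eq_sym y0 eq_sym xy0 xy /=.
  by rewrite -subr_eq0 opprD addNKr oppr_eq0 y0 eq_sym -subr_eq0 addrK x0.
rewrite -[4%N]/(size [:: 0; x; y; x + y]); apply: uniq_leq_size => // w.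
rewrite !inE !subsums_consE !subsums_nil !inE subr_eq0 => /or4P[]/eqP->.
- by apply/orP; left; rewrite eqxx.
- by apply/or3P/Or32; rewrite subrr.
- by apply/or3P/Or31; rewrite eqxx orbT.
- by apply/or3P/Or33; rewrite [x + y - x]addrAC subrr add0r subrr.
Qed.

Lemma nzsums_uniq_linear S : zsf S -> uniq S -> (3 * size S <= 2 * nzsums S + 1)%N.
Proof.
have [n] := ubnP (size S); elim: n S => // n IH [|x [|y S]] /= lt z u.
- by [].
- by rewrite nzsums1.
have {}IH : (3 * size S <= 2 * nzsums S + 1)%N.
  apply: IH; first by lia.
    exact: (@zsf_catr _ [:: x; y] S).
  by case/and3P: u.
have := @nzsums_cat _ [:: x; y] S z => /=.
have := @nzsums_pair x y (@zsf_catl _ [:: x; y] S z).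
have -> : x != y by move: u; rewrite /= inE negb_or => /andP[/andP[]].
by move=> /(_ isT); lia.
Qed.

End Restart.

(** * Numerical estimates for the quadratic lower bound *)

Section QuadraticBound.
Variable R : rcfType.
Implicit Types (y z : R).

(** The main term is [s ^ 2 / 6]; the second term, of order [s ^ (3/2)], pays for the
first additions, where growth is bounded by the size of the current set, and for
the remainders of the induction. *)
Definition qbound (s : nat) : R :=
  Num.sqrt s%:R ^+ 3 * (Num.sqrt s%:R - 4) / 6.

Lemma sqr_sqrtn (s : nat) : Num.sqrt (s%:R : R) ^+ 2 = s%:R.
Proof. by rewrite sqr_sqrtr ?ler0n. Qed.

(** State of the greedy construction when [i] out of [s] elements have produced [a]
sums.  The first four elements at least double the number of sums.  Then comes an
exponential phase, ending at [i = k + 4], and afterwards a linear phase, where an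
addition with [r] elements left produces at least [(2 r + 1) / 6] new sums; these
terms add up to a difference of two values of [r (r + 2) / 6].  The last clause
says that the linear phase has begun only if its step does not exceed the
exponential step [3 a / 4]. *)
Definition phase (s i a : nat) : Prop :=
  ((i <= 4)%N /\ (2 ^ i <= a)%N) \/
  exists2 k : nat, (k + 4 <= i <= s)%N &
    16 * (7 / 4) ^+ k + ((s - (k + 4))%N%:R * ((s - (k + 4))%N%:R + 2) -
      (s - i)%N%:R * ((s - i)%N%:R + 2)) / 6 <= a%:R :> R /\
    (i = (k + 4)%N \/ (2 * (2 * (s - i) + 1) <= 9 * a)%N).

(** The two bounds of [olson_growth] combined: [g >= min (3 a / 4) ((2 b + 1) / 6)]. *)
Lemma growth_min (a b g : nat) : (a * (2 * b).+1 <= a ^ 2 + 2 * b * g)%N ->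
  ((2 * b < 2 * a)%N -> (2 * b < 6 * g)%N) ->
  (3 * a <= 4 * g)%N \/ (2 * b + 1 <= 6 * g)%N.
Proof.
rewrite expnS expn1 => H1 H2; have [le|lt] := leqP (2 * a) (2 * b); last first.
  by right; have := H2 lt; lia.
have [le4|lt4] := leqP (4 * a) (2 * b + 1); [left|right].
  have [b0|b0] := posnP b; first by lia.
  have H3 : (3 * a * (2 * b) <= 4 * g * (2 * b))%N by nia.
  by rewrite leq_pmul2r in H3; lia.
have H3 : (3 * (2 * b + 1) * (2 * b) <= 16 * g * (2 * b))%N.
  have : (0 <= (4 * a%:Z - (2 * b%:Z + 1)) * (3 * (2 * b%:Z + 1) - 4 * a%:Z)) by nia.
  by nia.
by rewrite leq_pmul2r in H3; lia.
Qed.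

Lemma phase_step (s i a g : nat) (b := (s - i)%N) : (32 <= s)%N -> (0 < b)%N ->
  (a * (2 * b).+1 <= a ^ 2 + 2 * b * g)%N ->
  ((2 * b < 2 * a)%N -> (2 * b < 6 * g)%N) ->
  phase s i a -> phase s i.+1 (a + g).
Proof.
move=> s32 b_gt0 H1 H2 ph.
have step4 : (4 <= i)%N -> (exists2 k : nat, (k + 4 <= i <= s)%N &
    16 * (7 / 4) ^+ k + ((s - (k + 4))%N%:R * ((s - (k + 4))%N%:R + 2) -
      (s - i)%N%:R * ((s - i)%N%:R + 2)) / 6 <= a%:R :> R /\
    (i = (k + 4)%N \/ (2 * (2 * (s - i) + 1) <= 9 * a)%N)) -> phase s i.+1 (a + g).
  move=> i4 [k ki [le_a st]]; right.
  have bE : (s - i)%N%:R = (s - i.+1)%N%:R + 1 :> R.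
    by rewrite natr1; congr _%:R; rewrite /b in b_gt0; lia.
  have gm := growth_min H1 H2.
  have [le9|lt9] := leqP (9 * a) (2 * (2 * (s - i) + 1)).
    have ge34 : (3 * a <= 4 * g)%N by case: gm; rewrite /b; lia.
    case: st => [iE|eq9].
      exists k.+1; first by lia.
      split; last by left; lia.
      rewrite addSn -iE subrr mul0r addr0.
      rewrite -iE subrr mul0r addr0 in le_a.
      rewrite exprS natrD.
      have : 3 * a%:R <= 4 * g%:R :> R by rewrite -!natrM ler_nat.
      by lra.
    have e : (2 * (2 * (s - i) + 1))%N = (9 * a)%N by lia.
    exists k; first by lia.
    split; last by right; lia.
    rewrite natrD; move: le_a.
    have : 2 * (2 * (s - i)%N%:R + 1) = 9 * a%:R :> R.
      by rewrite -[1]/(1%:R) -!natrM -natrD -natrM e natrM.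
    have : 3 * a%:R <= 4 * g%:R :> R by rewrite -!natrM ler_nat.
    rewrite bE; move: (s - i.+1)%N%:R (s - (k + 4))%N%:R ((7 / 4) ^+ k) => x y z.
    by nra.
  have ge6 : (2 * b + 1 <= 6 * g)%N by case: gm; rewrite /b in lt9 *; lia.
  exists k; first by lia.
  split; last by right; lia.
  rewrite natrD; move: le_a.
  have : 2 * (s - i)%N%:R + 1 <= 6 * g%:R :> R.
    by rewrite -[1]/(1%:R) -!natrM -natrD ler_nat.
  rewrite bE; move: (s - i.+1)%N%:R (s - (k + 4))%N%:R ((7 / 4) ^+ k) => x y z.
  by nra.
case: ph => [[i4 ge_a]|ph]; last by apply: step4 => //; case: ph => k; lia.
have [lt4|eq4] : ((i < 4) \/ (i = 4))%N by lia.
  left; split=> //; rewrite expnS expn1 in H1.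
  rewrite expnS; have [//|lt] := leqP (2 * 2 ^ i) a; first by lia.
  have : (29 <= b)%N by lia.
  move=> b29; rewrite leqNgt; apply/negP => lt_g.
  have {H1 H2} : (58 * (2 * a - 2 * 2 ^ i + 1) <= a * a - a)%N.
    have le_b : (2 * b * g <= 2 * b * (2 * 2 ^ i - 1 - a))%N by rewrite leq_mul2l; lia.
    move: (2 ^ i)%N => c in ge_a lt lt_g le_b *.
    have le1 : (58 * (2 * a - 2 * c + 1) <= 2 * b * (2 * a - 2 * c + 1))%N.
      by rewrite leq_mul2r; lia.
    have : (2 * b * (2 * a - 2 * c + 1) + 2 * b * (2 * c - 1 - a) = 2 * b * a)%N.
      by rewrite -mulnDr; congr (_ * _)%N; lia.
    by lia.
  have : (a * a + 2 ^ i * (2 * 2 ^ i - 1) <= a * (2 ^ i + (2 * 2 ^ i - 1)))%N.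
    by move: (2 ^ i)%N ge_a lt => c ge_a lt; nia.
  by move: ge_a lt; case: i lt4 {b b_gt0 b29 lt_g i4 step4} => [|[|[|[|]]]] //= _; lia.
apply: step4; first by rewrite eq4.
exists 0%N; first by lia.
split; last by left.
by rewrite eq4 subrr mul0r addr0 expr0 mulr1 (ler_nat _ 16); move: ge_a; rewrite eq4.
Qed.

(** A cubic lower bound of the exponential phase, with the constant that
[cubic_ineq] requires. *)
Lemma exp_cubic (k : nat) :
  1 + 1694 / 10000 * (k + 4)%:R ^+ 3 <= 16 * (7 / 4) ^+ k :> R.
Proof.
case: k => [|k]; first by rewrite expr0 add0n; lra.
elim: k => [|k IH]; first by rewrite expr1; lra.
rewrite [(7 / 4) ^+ k.+2]exprS.
have -> : (k.+2 + 4)%:R = (k.+1 + 4)%:R + 1 :> R by rewrite natr1.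
have : 5 <= (k.+1 + 4)%:R :> R by rewrite (ler_nat _ 5); lia.
move: IH; move: (k.+1 + 4)%:R ((7 / 4) ^+ k.+1) => x p IH x5.
have : (x + 1) ^+ 3 <= 7 / 4 * x ^+ 3.
  have -> : 7 / 4 * x ^+ 3 = (x + 1) ^+ 3 +
    ((x - 5) * (3/4 * x ^+ 2 + 3/4 * x + 3/4) + 11/4) by field.
  rewrite lerDl addr_ge0 ?mulr_ge0 ?subr_ge0 //; last by lra.
  by rewrite addr_ge0 ?addr_ge0 ?mulr_ge0 ?sqr_ge0 //; lra.
by lra.
Qed.

(** Weighted inequality between arithmetic and geometric means, with near equality at
[y = 1.2301 J].  The coefficient of [y ^ 3] is [(2/3) (1 - (9/10) ^ 3)], the slack
in the terms of order [3/2] of [qbound] when the number of elements drops from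
[y ^ 2] to at most [(9/10 y) ^ 2]. *)
Lemma cubic_ineq (J y : R) : 0 <= J -> 0 <= y ->
  J / 3 * y ^+ 2 <= 271 / 1500 * y ^+ 3 + 1694 / 10000 * J ^+ 3.
Proof.
move=> J0 y0; have : 0 <= (y - 12301/10000 * J) ^+ 2 * (y + 12301/20000 * J).
  by rewrite mulr_ge0 ?sqr_ge0 //; nra.
have : 0 <= J * y ^+ 2 by rewrite mulr_ge0 // sqr_ge0.
have : 0 <= J ^+ 3 by rewrite exprn_ge0.
by nra.
Qed.

Lemma qbound_small (s : nat) (f : nat) : (s <= 31)%N -> (3 * s <= 2 * f + 1)%N ->
  qbound s <= f%:R.
Proof.
move=> s31 le_f; rewrite /qbound; have ye := sqr_sqrtn s.
have y0 : 0 <= Num.sqrt (s%:R : R) by apply: sqrtr_ge0.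
have le1 : 3 * s%:R <= 2 * f%:R + 1 :> R.
  by rewrite -[1]/(1%:R) -!natrM -natrD ler_nat.
have le2 : s%:R <= 31 :> R by rewrite (ler_nat _ _ 31).
have le3 : 0 <= f%:R :> R by apply: ler0n.
move: ye y0 le1 le2 le3; set y := Num.sqrt _; move: y s%:R f%:R.
move=> y x w ye y0 le1 le2 le3.
have [y4|y4] := leP y 4.
  apply: le_trans le3.
  have : 0 <= y ^+ 3 * (4 - y) by rewrite mulr_ge0 ?exprn_ge0 // subr_ge0.
  by lra.
have y557 : y <= 5568/1000 by nra.
have -> : y ^+ 3 * (y - 4) = y ^+ 2 * (y * (y - 4)) by ring.
have : y * (y - 4) <= 874/100 by nra.
have : 0 <= y ^+ 2 by rewrite sqr_ge0.
by rewrite ye; nra.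
Qed.

(** Here and in [qbound_restart_late], [y ^ 2] elements are given and [z ^ 2] of them
remain, all in a small subgroup; [f] bounds the sums of these.  If most elements
remain, doubling [f] by [nzsums_subgroup] is enough, since
[2 * (9/10) ^ 4 > 1]. *)
Lemma qbound_restart_early (y z f : R) : 5 <= y -> 9/10 * y <= z ->
  z ^+ 3 * (z - 4) / 6 <= f -> 3 * z ^+ 2 <= 2 * f + 1 ->
  y ^+ 3 * (y - 4) / 6 <= 2 * f.
Proof.
move=> y5 zy le1 le2; have y0 : 0 <= y by lra.
have [y6|y6] := leP y 6.
  have -> : y ^+ 3 * (y - 4) = y ^+ 2 * (y * (y - 4)) by ring.
  have : y * (y - 4) <= 12 by nra.
  have : 81/100 * y ^+ 2 <= z ^+ 2 by nra.
  by nra.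
have zz : (9/10 * y) ^+ 3 <= z ^+ 3 by rewrite lerXn2r ?nnegrE; lra.
have : (9/10 * y) ^+ 3 * (9/10 * y - 4) <= z ^+ 3 * (z - 4).
  by apply: ler_pM => //; rewrite ?exprn_ge0; lra.
have : 0 <= y ^+ 3 * (y - 6) by rewrite mulr_ge0 ?exprn_ge0; lra.
have -> : (9/10 * y) ^+ 3 * (9/10 * y - 4) =
  729/1000 * (9/10 * y ^+ 4 - 4 * y ^+ 3) by field.
have -> : y ^+ 3 * (y - 6) = y ^+ 4 - 6 * y ^+ 3 by ring.
have -> : y ^+ 3 * (y - 4) = y ^+ 4 - 4 * y ^+ 3 by ring.
have : 0 <= y ^+ 3 by rewrite exprn_ge0.
by lra.
Qed.

(** If many elements have been used up, the [a - 1] nonzero sums they produced, added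
to [f], are enough.  [J] is the length of the exponential phase: its steps lack
about [J y ^ 2 / 3] against the linear rate, which [cubic_ineq] compensates. *)
Lemma qbound_restart_late (y z a f J P : R) : 0 <= z -> z <= 9/10 * y ->
  4 <= J -> J <= y ^+ 2 - z ^+ 2 ->
  1 + 1694 / 10000 * J ^+ 3 <= P ->
  P + ((y ^+ 2 - J) * (y ^+ 2 - J + 2) - z ^+ 2 * (z ^+ 2 + 2)) / 6 <= a ->
  z ^+ 3 * (z - 4) / 6 <= f ->
  y ^+ 3 * (y - 4) / 6 <= a - 1 + f.
Proof.
move=> z0 zy J4 Jyz; have y0 : 0 <= y by lra.
have zz : z ^+ 3 <= (9/10 * y) ^+ 3 by rewrite lerXn2r ?nnegrE //; lra.
have J0 : 0 <= J by lra.
have J2 : 0 <= J * (J - 2) by rewrite mulr_ge0 //; lra.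
have cub := cubic_ineq J0 y0.
move=> leP lea lef; move: zz; rewrite exprMn.
have -> : y ^+ 3 * (y - 4) = y ^+ 4 - 4 * y ^+ 3 by ring.
move: lef; have -> : z ^+ 3 * (z - 4) = z ^+ 4 - 4 * z ^+ 3 by ring.
move: lea; have -> : (y ^+ 2 - J) * (y ^+ 2 - J + 2) - z ^+ 2 * (z ^+ 2 + 2) =
  y ^+ 4 - z ^+ 4 + 2 * (y ^+ 2 - z ^+ 2) - 2 * (J * y ^+ 2) + J * (J - 2) by ring.
by lra.
Qed.

Lemma qbound_restart (s r a fa fb : nat) : (32 <= s)%N -> (r <= s)%N ->
  phase s (s - r) a -> (a <= fa.+1)%N -> qbound r <= fb%:R -> (3 * r <= 2 * fb + 1)%N ->
  qbound s <= (maxn (2 * fb) (fa + fb))%:R.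
Proof.
move=> s32 le_rs ph le_a; rewrite /qbound => le_b le_r.
have ye := sqr_sqrtn s; have ze := sqr_sqrtn r.
have y0 : 0 <= Num.sqrt (s%:R : R) by apply: sqrtr_ge0.
have z0 : 0 <= Num.sqrt (r%:R : R) by apply: sqrtr_ge0.
have s32' : 32 <= s%:R :> R by rewrite (ler_nat _ 32).
move: ye ze y0 z0 le_b; set y := Num.sqrt s%:R; set z := Num.sqrt r%:R.
move: y z => y z ye ze y0 z0 le_b.
have [zy|zy] := leP (9/10 * y) z.
  apply: (@le_trans _ _ (2 * fb)%:R); last by rewrite ler_nat leq_maxl.
  rewrite natrM; apply: (@qbound_restart_early y z) => //; first by nra.
  by rewrite ze -[1]/(1%:R) -!natrM -natrD ler_nat.
apply: (@le_trans _ _ (fa + fb)%:R); last by rewrite ler_nat leq_maxr.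
have lt_r : (100 * r < 81 * s)%N.
  by rewrite -(ltr_nat R) !natrM -ye -ze; nra.
have sr : (s - (s - r))%N = r by lia.
case: ph => [[]|[k k_le [le _]]]; first by lia.
have lea : a%:R <= fa%:R + 1 :> R by rewrite natr1 ler_nat.
rewrite natrD.
have -> : fa%:R + fb%:R = (fa%:R + 1) - 1 + fb%:R :> R by ring.
apply: (@qbound_restart_late y z (fa%:R + 1) fb%:R (k + 4)%:R (16 * (7 / 4) ^+ k)) => //.
- exact: ltW.
- by rewrite (ler_nat _ 4) leq_addl.
- by rewrite ye ze -natrB // ler_nat; lia.
- exact: exp_cubic.
apply: le_trans lea; move: le; rewrite sr natrB; last by lia.
by rewrite ye ze.
Qed.

End QuadraticBound.

(** * Zero-sum-free sets have quadratically many sums *)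

Section Quadratic.
Local Open Scope fset_scope.
Local Open Scope ring_scope.
Variables (R : rcfType) (G : zmodType).
Implicit Types (A K : {fset G}) (B U S : seq G) (x y z : G).

Lemma zsf_neq0 x S : zsf S -> x \in S -> x != 0.
Proof.
move=> z xS; have := zsf_cons (zsf_perm (perm_to_rem xS) z) (subsums0 _).
by rewrite addr0.
Qed.

(** In the absence of involutions, a zero-sum-free set is disjoint from its opposite,
as [olson_growth] requires. *)
Lemma zsf_oppN S : zsf S -> uniq S -> (forall x, x \in S -> x + x != 0) ->
  forall x, x \in S -> - x \notin S.
Proof.
move=> z u ninv x xS; apply/negP => NxS.
have zr := zsf_perm (perm_to_rem xS) z.
have ne : - x != x by have := ninv _ xS; rewrite -[x in x + _]opprK addrC subr_eq0 eq_sym.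
have : x + (- x) != 0.
  apply: zsf_cons zr _; rewrite (subsums_perm (perm_to_rem (x := - x) _)).
    by rewrite subsums_consE subrr subsums0 orbT.
  by rewrite mem_rem_uniq // inE ne.
by rewrite subrr eqxx.
Qed.

Lemma card_subsums_cons x U :
  #|` subsums (x :: U)| = (#|` subsums U| + growth (subsums U) x)%N.
Proof.
have -> : subsums (x :: U) = subsums U `|` (shift (subsums U) x `\` subsums U).
  by apply/fsetP => y; rewrite subsums_consE !inE in_shift; case: (y \in subsums U).
rewrite /growth -cardfsUI.
have -> : subsums U `&` (shift (subsums U) x `\` subsums U) = fset0.
  by apply/fsetP => y; rewrite !inE; case: (y \in subsums U).
by rewrite cardfs0 addn0.
Qed.

Lemma subgroup0 : subgroup ([fset 0] : {fset G}).
Proof.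
split; rewrite ?inE // => x; first by move=> y; rewrite !inE => /eqP-> /eqP->; rewrite addr0.
by rewrite !inE oppr_eq0.
Qed.

Lemma subsums_involutions U : zsf U -> (forall x, x \in U -> x + x = 0) ->
  #|` subsums U| = (2 ^ size U)%N.
Proof.
move=> z inv.
have closed V : (forall x, x \in V -> x + x = 0) -> forall y w,
    y \in subsums V -> w \in subsums V -> y + w \in subsums V.
  elim: V => [|x V IH] invV y w.
    by rewrite subsums_nil !inE => /eqP -> /eqP ->; rewrite addr0.
  have invV' v : v \in V -> v + v = 0 by move=> vV; apply: invV; rewrite inE vV orbT.
  have {}IH := IH invV'.
  have x2 : - x = x by apply/eqP; rewrite eq_sym -subr_eq0 opprK invV ?mem_head.
  rewrite !subsums_consE !x2 => /orP[yV|yV] /orP[wV|wV]; apply/orP.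
  - by left; apply: IH.
  - by right; rewrite -addrA IH.
  - by right; rewrite addrAC IH.
  - left; have := IH _ _ yV wV; rewrite addrACA invV ?mem_head // addr0 //.
elim: U z inv => [|x U IH] z inv; first by rewrite subsums_nil cardfs1.
have invU y : y \in U -> y + y = 0 by move=> yU; apply: inv; rewrite inE yU orbT.
have x2 : x + x = 0 by apply: inv; rewrite mem_head.
rewrite card_subsums_cons IH //; last exact: (@zsf_catr _ [:: x] U).
have -> : growth (subsums U) x = (2 ^ size U)%N.
  rewrite -(IH (@zsf_catr _ [:: x] U z) invU) -(card_shift _ x) /growth; congr #|` _|.
  apply/fsetP => y; rewrite !inE in_shift andb_idl // => yxU; apply/negP => yU.
  have yy : y + y = 0.
    case/subsumsP: yU => t [u [pU ->]]; rewrite -big_split big1_seq // => w /andP[_ wt].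
    by apply: invU; rewrite (perm_mem pU) mem_cat wt.
  have := zsf_cons z (closed _ invU _ _ yU yxU).
  by rewrite [y + _]addrA yy add0r subrr eqxx.
by rewrite expnS mul2n addnn.
Qed.

(** Greedy construction: start from the involutions in [S], which double the number
of sums, and then add at each step the element given by [olson_growth].  When the
remaining elements lie in a small subgroup, apply induction to them and combine
the result with the sums obtained so far by [qbound_restart]. *)
Theorem nzsums_quadratic S : zsf S -> uniq S -> qbound R (size S) <= (nzsums S)%:R.
Proof.
have [n] := ubnP (size S); elim: n S => // n IH S; rewrite ltnS => le_n z u.
have lin := nzsums_uniq_linear z u.
have [s31|s32] := leqP (size S) 31; first exact: qbound_small.
have restart U B K : perm_eq S (U ++ B) -> phase R (size S) (size U) #|` subsums U| ->
    subgroup K -> {subset B <= K} -> (#|` K| < 2 * #|` subsums U|)%N ->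
    qbound R (size S) <= (nzsums S)%:R.
  move=> pS ph gK sBK ltK.
  have zUB := zsf_perm pS z.
  have uB : uniq B by move: u; rewrite (perm_uniq pS) cat_uniq => /and3P[].
  have zB := zsf_catr zUB.
  have sizeS : size S = (size U + size B)%N by rewrite (perm_size pS) size_cat.
  have U_gt0 : (0 < size U)%N.
    rewrite lt0n size_eq0; apply/eqP => U0; move: ltK sizeS.
    rewrite U0 subsums_nil cardfs1 /= add0n => ltK sizeS.
    case: B sizeS {pS uB} zB zUB sBK => [|b B] sizeS zB _ sBK; first by move: s32; rewrite sizeS.
    have b0 := zsf_neq0 zB (mem_head _ _).
    have : (#|` [fset (0%R : G); b]| <= #|` K|)%N.
      apply: fsubset_leq_card; apply/fsubsetP => x; rewrite !inE.
      by case/orP => /eqP ->; [case: gK | rewrite sBK ?mem_head].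
    by rewrite cardfs2 eq_sym b0 /= => le_K; lia.
  have lt_B : (size B < n)%N by lia.
  have := qbound_restart (s := size S) (r := size B) (a := #|` subsums U|)
    (fa := nzsums U) (fb := nzsums B) (R := R) s32.
  move=> /(_ _ _ _ _ _)/wrap[]; rewrite ?subsums_card //.
  - by lia.
  - by rewrite -subsums_card; have -> : (size S - size B = size U)%N by lia.
  - exact: IH.
  - exact: nzsums_uniq_linear.
  move=> le; apply: le_trans le _; rewrite ler_nat geq_max (nzsums_perm pS).
  by rewrite (nzsums_subgroup zUB gK sBK ltK) nzsums_cat.
(* An exhausted B lies in the trivial subgroup, so the end of the construction is
   the restart with K = {0}. *)
have main m : forall B U, (size B <= m)%N -> perm_eq S (U ++ B) ->
    (forall x, x \in B -> x + x != 0) -> phase R (size S) (size U) #|` subsums U| ->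
    qbound R (size S) <= (nzsums S)%:R.
  elim: m => [|m IHm] B U.
    rewrite leqn0 size_eq0 => /eqP -> pS _ ph; apply: restart pS ph subgroup0 _ _ => //.
    by rewrite cardfs1 subsums_card; lia.
  move=> le_m pS ninv ph; have [B0|B0] := eqVneq B [::].
    by move: pS ninv ph; rewrite B0 => pS; apply: IHm.
  have zUB := zsf_perm pS z.
  have uB : uniq B by move: u; rewrite (perm_uniq pS) cat_uniq => /and3P[].
  have A_gt0 : (0 < #|` subsums U|)%N by rewrite subsums_card.
  case: (olson_growth A_gt0 B0 uB (zsf_oppN (zsf_catr zUB) uB ninv)).
    by case=> K [gK sBK ltK]; apply: restart pS ph gK sBK ltK.
  case=> x xB [g1 g2].
  have pB := perm_to_rem xB.
  have sizeB : size B = (size S - size U)%N by rewrite (perm_size pS) size_cat addKn.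
  apply: (IHm (rem x B) (x :: U)).
  - by rewrite size_rem // -subn1 leq_subLR.
  - apply: perm_trans pS _; rewrite perm_sym -cat1s -catA perm_catCA perm_cat2l perm_sym.
    exact: pB.
  - by move=> y /mem_rem; apply: ninv.
  rewrite card_subsums_cons; apply: phase_step => //; rewrite -?sizeB //.
  by rewrite lt0n size_eq0.
pose U := [seq x <- S | x + x == 0]; pose B := [seq x <- S | x + x != 0].
have pS : perm_eq S (U ++ B) by rewrite perm_sym perm_filterC.
apply: (main _ B U (leqnn _) pS).
  by move=> x; rewrite mem_filter => /andP[].
rewrite subsums_involutions; last first.
- by move=> x; rewrite mem_filter => /andP[/eqP].
- exact: zsf_catl (zsf_perm pS z).
have [le4|lt4] := leqP (size U) 4; first by left.
have le_US : (size U <= size S)%N by rewrite (perm_size pS) size_cat leq_addr.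
right; exists (size U - 4)%N; rewrite subnK ?(ltnW lt4) //; first by rewrite leqnn.
split; last by left.
rewrite subrr mul0r addr0 natrX -[X in 2 ^+ X](subnK (ltnW lt4)) exprD mulrC.
have -> : (2 : R) ^+ 4 = 16 by lra.
by rewrite ler_pM2r ?lerXn2r ?nnegrE //; lra.
Qed.

End Quadratic.

(** * Layers and overflow of a sequence *)

Section Counting.
Variable T : eqType.
Implicit Types (s t r : seq T) (x y : T).

Lemma count_le_perm s t : (forall x, (count_mem x t <= count_mem x s)%N) ->
  exists r, perm_eq s (t ++ r).
Proof.
elim: t s => [|y t IH] s le_ts; first by exists s.
have ys : y \in s.
  by rewrite -has_pred1 has_count; apply: leq_trans (le_ts y); rewrite /= eqxx.
have [x|r pr] := IH (rem y s).
  by have := le_ts x; rewrite (permP (perm_to_rem ys)) /= leq_add2l.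
exists r; apply: perm_trans (perm_to_rem ys) _.
by rewrite cat_cons perm_cons.
Qed.

Lemma count_flatten_uniq (F : T -> seq T) (k : T -> nat) r : uniq r ->
  (forall x y, count_mem y (F x) = if x == y then k x else 0%N) ->
  forall y, count_mem y (flatten (map F r)) = if y \in r then k y else 0%N.
Proof.
move=> ur Fk y; elim: r ur => [|x r IH] //= /andP[xr /IH {}IH].
rewrite count_cat Fk IH inE eq_sym; case: eqVneq => [e|//].
by rewrite e (negbTE xr) addn0.
Qed.

Lemma count_mem_nseq n x y : count_mem y (nseq n x) = if x == y then n else 0%N.
Proof. by rewrite count_nseq /=; case: eqP; rewrite ?mul1n ?mul0n. Qed.

Lemma perm_flatten_cat (I : Type) (F H : I -> seq T) (r : seq I) :
  perm_eq (flatten [seq F i ++ H i | i <- r])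
          (flatten (map F r) ++ flatten (map H r)).
Proof.
elim: r => //= i r IH; apply/permP => a; have /permP/(_ a) := IH.
by rewrite !count_cat; lia.
Qed.

Definition layer s i := [seq x <- undup s | (i < count_mem x s)%N].
Definition overflow s c := flatten [seq nseq (count_mem x s - c) x | x <- undup s].

Lemma layers_perm s c :
  perm_eq s (flatten [seq layer s i | i <- iota 0 c] ++ overflow s c).
Proof.
have min_sum y : count_mem y (flatten [seq layer s i | i <- iota 0 c]) =
    minn c (count_mem y s).
  rewrite count_flatten -map_comp (eq_map (g := fun i => (i < count_mem y s)%N : nat)).
    elim: c => [|c IH]; first by rewrite min0n.
    rewrite -addn1 iotaD map_cat sumn_cat IH /= add0n addn0.
    by case: ltnP => /=; lia.
  move=> i /=; rewrite count_uniq_mem ?filter_uniq ?undup_uniq // mem_filter mem_undup.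
  by case: ltnP => //= lt_i; rewrite -has_pred1 has_count (leq_ltn_trans _ lt_i).
apply/allP => y _ /=; rewrite count_cat min_sum.
rewrite (@count_flatten_uniq _ (fun x => count_mem x s - c)%N) ?undup_uniq //; last first.
  by move=> x z; rewrite count_mem_nseq.
rewrite mem_undup; have [ys|yNs] := boolP (y \in s); first by apply/eqP; lia.
by rewrite (count_memPn yNs) minn0.
Qed.

Lemma size_overflow s c :
  size (overflow s c) = (\sum_(x <- undup s) (count_mem x s - c))%N.
Proof.
rewrite /overflow size_flatten /shape -map_comp sumnE big_map.
by apply: eq_bigr => x _; rewrite /= size_nseq.
Qed.

End Counting.

(** * The overflow contains almost all terms *)

Section Loss.
Local Open Scope fset_scope.
Local Open Scope ring_scope.
Variables (R : rcfType) (G : zmodType).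

(** As a function of [l], [qbound] lies above its tangent at [l = Y ^ 2]; the
difference is [(sqrt l - Y) ^ 2] times a nonnegative factor. *)
Lemma qbound_tangent (Y : R) (l : nat) : 2 <= Y ->
  Y ^+ 3 * (Y - 4) / 6 + (Y ^+ 2 / 3 - Y) * (l%:R - Y ^+ 2) <= qbound R l.
Proof.
move=> Y2; rewrite /qbound; have := sqr_sqrtn R l.
have : 0 <= Num.sqrt (l%:R : R) by apply: sqrtr_ge0.
set y := Num.sqrt l%:R; move: y => y y0 <-; rewrite -subr_ge0.
have -> : y ^+ 3 * (y - 4) / 6 -
    (Y ^+ 3 * (Y - 4) / 6 + (Y ^+ 2 / 3 - Y) * (y ^+ 2 - Y ^+ 2)) =
    (y - Y) ^+ 2 * (y ^+ 2 + 2 * (Y - 2) * y + Y * (Y - 2)) / 6 by field.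
rewrite divr_ge0 // mulr_ge0 ?sqr_ge0 // !addr_ge0 ?sqr_ge0 ?mulr_ge0 //; lra.
Qed.

(** Here [Y ^ 2 = sqrt (6 n)]; [L] and [m] are the lengths of the layers and
of the overflow, and [f] is the number of nonzero sums.  The tangent at
[Y ^ 2], the length of each layer in the critical case [L = c Y ^ 2], makes the
bound for [f] linear and increasing in [L].  In the critical case the
bounds on [f] contradict each other because
[Y ^ 2 * ((Y - 2 c) ^ 2 / 6 + c (c - 3) / 3) >= 0]. *)
Lemma loss_ineq (c : nat) (Y m n L f : R) : (2 <= c)%N -> 6 <= Y -> n = Y ^+ 4 / 6 ->
  n = L + m -> f + 1 < c%:R * n - c%:R ^+ 2 * Y ^+ 2 ->
  c%:R * (Y ^+ 3 * (Y - 4) / 6) + (Y ^+ 2 / 3 - Y) * (L - c%:R * Y ^+ 2) + m <= f ->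
  n - c%:R * Y ^+ 2 < m.
Proof.
move=> c2 Y6 nE nLm ltf lef; rewrite ltNge; apply/negP => le_m.
have D0 : 0 <= (Y ^+ 2 / 3 - Y - 1) * (L - c%:R * Y ^+ 2).
  by rewrite mulr_ge0 //; [nra|lra].
have : Y ^+ 2 * ((Y - 2 * c%:R) ^+ 2 / 6 + c%:R * (c%:R - 3) / 3) < 0.
  have -> : Y ^+ 2 * ((Y - 2 * c%:R) ^+ 2 / 6 + c%:R * (c%:R - 3) / 3) =
    Y ^+ 4 / 6 - 2 / 3 * c%:R * Y ^+ 3 + c%:R ^+ 2 * Y ^+ 2 - c%:R * Y ^+ 2 by field.
  move: D0 lef ltf; rewrite nLm in nE.
  have -> : m = Y ^+ 4 / 6 - L by lra.
  have -> : n = Y ^+ 4 / 6 by lra.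
  have -> : (Y ^+ 2 / 3 - Y - 1) * (L - c%:R * Y ^+ 2) =
    (Y ^+ 2 / 3 - Y) * (L - c%:R * Y ^+ 2) - L + c%:R * Y ^+ 2 by ring.
  have -> : Y ^+ 3 * (Y - 4) = Y ^+ 4 - 4 * Y ^+ 3 by ring.
  by lra.
apply/negP; rewrite -leNgt mulr_ge0 ?sqr_ge0 //.
have [c3|c3] := leqP 3 c.
  have c3' : 3 <= c%:R :> R by rewrite (ler_nat _ 3).
  by rewrite addr_ge0 // divr_ge0 ?sqr_ge0 ?mulr_ge0 //; lra.
have -> : c = 2%N by lia.
by nra.
Qed.

(** The last two inequalities are what the structural part uses: the number of
sums is below [c * m], with [m] large against [c ^ 3]. *)
Lemma overflow_bounds (s : seq G) (c n m : nat) : zsf s -> (2 <= c)%N -> n = size s ->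
    ((4 * c) ^ 3 <= n)%N -> m = (\sum_(x <- undup s) (count_mem x s - c))%N ->
    (#|` subsums s|)%:R < c%:R * n%:R - c%:R ^+ 2 * Num.sqrt (6 * n%:R) :> R ->
  [/\ n%:R - c%:R * Num.sqrt (6 * n%:R) < m%:R :> R, (nzsums s < c * m)%N &
      (36 * c ^ 3 <= m)%N].
Proof.
move=> z c2 ns le_n mE; rewrite subsums_card -natr1 => ltS.
pose ls := [seq layer s i | i <- iota 0 c].
have pS := layers_perm s c; rewrite -/ls in pS.
have zS := zsf_perm pS z.
have le1 : (\sum_(l <- ls) nzsums l + m <= nzsums s)%N.
  rewrite (nzsums_perm pS); apply: leq_trans (nzsums_cat zS).
  apply: leq_add; first exact: nzsums_flatten (zsf_catl zS).
  by rewrite mE -size_overflow; apply: nzsums_size (zsf_catr zS).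
have nLm : n = (\sum_(l <- ls) size l + m)%N.
  rewrite ns (perm_size pS) size_cat size_overflow -mE size_flatten /shape sumnE big_map.
  by [].
set M := Num.sqrt (6 * n%:R) in ltS *.
have M2 : M ^+ 2 = 6 * n%:R by rewrite sqr_sqrtr // mulr_ge0 ?ler0n.
have M0 : 0 <= M by apply: sqrtr_ge0.
pose Y := Num.sqrt M; have YM : Y ^+ 2 = M by rewrite sqr_sqrtr.
have Y0 : 0 <= Y by apply: sqrtr_ge0.
have nc : 64 * c%:R ^+ 3 <= n%:R :> R.
  by rewrite -natrX -(natrM _ 64) ler_nat; move: le_n; rewrite expnMn.
have c2' : 2 <= c%:R :> R by rewrite (ler_nat _ 2).
have c8 : 8 <= c%:R ^+ 3 :> R by rewrite -natrX (ler_nat _ 8) (@leq_exp2r 2 c 3).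
have n512 : 512 <= n%:R :> R by lra.
have M36 : 36 <= M by nra.
have Y6 : 6 <= Y by nra.
have Y2 : 2 <= Y by lra.
have ltm : n%:R - c%:R * M < m%:R.
  rewrite -YM; apply: (@loss_ineq c Y m%:R n%:R (\sum_(l <- ls) size l)%:R (nzsums s)%:R) => //.
  - by rewrite -[Y ^+ 4]/(Y ^+ (2 * 2)) exprM YM M2; field.
  - by rewrite -natrD nLm.
  - by rewrite YM.
  apply: (@le_trans _ _ (\sum_(l <- ls) nzsums l + m)%:R); last by rewrite ler_nat.
  rewrite natrD lerD2r.
  have -> : c%:R = (size ls)%:R :> R by rewrite size_map size_iota.
  have : forall l, l \in ls -> qbound R (size l) <= (nzsums l)%:R.
    move=> l lls; apply: nzsums_quadratic.
      apply: zsf_catl (zsf_perm _ (zsf_catl zS)).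
      by apply: perm_flatten (perm_to_rem lls).
    by case/mapP: lls => i _ ->; rewrite filter_uniq ?undup_uniq.
  elim: (ls) => [|l l' IH] le_l; first by rewrite !big_nil !mul0r !subr0 mulr0 addr0.
  have := le_l l (mem_head _ _); have := qbound_tangent (size l) Y2.
  have {}IH := IH (fun k kl => le_l k (@mem_behead _ (l :: l') k kl)); move: IH.
  by rewrite !big_cons !natrD -[(size (l :: l'))%:R]natr1; lra.
have n1c : (6 * c%:R ^+ 2 <= (7/16) ^+ 2 * n%:R :> R).
  have : 32 * c%:R ^+ 2 <= 16 * c%:R ^+ 3 :> R.
    have : 0 <= c%:R ^+ 2 * (c%:R - 2) :> R by rewrite mulr_ge0 ?sqr_ge0 // subr_ge0.
    have -> : c%:R ^+ 2 * (c%:R - 2) = c%:R ^+ 3 - 2 * c%:R ^+ 2 :> R by ring.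
    by lra.
  by lra.
have cM : c%:R * M <= 7/16 * n%:R.
  rewrite -(@ler_pXn2r _ 2) ?nnegrE ?mulr_ge0 ?ler0n //; last by lra.
  rewrite exprMn M2 [leRHS]exprMn; have := ler_wpM2r (ler0n R n) n1c; lra.
split=> //.
- rewrite -(ltr_nat R) natrM.
  have : c%:R * (n%:R - c%:R * M) <= c%:R * m%:R by rewrite ler_pM2l ?ltW //; lra.
  by lra.
rewrite -(ler_nat R) natrM natrX; lra.
Qed.

End Loss.

(** * Progressions among subsequence sums *)

Section Covers.
Local Open Scope fset_scope.
Local Open Scope ring_scope.
Variable G : zmodType.
Implicit Types (s t u : seq G) (v w x y : G).

Definition covers v s n := forall j, (j <= n)%N -> v *+ j \in subsums s.

Lemma covers_le v s m n : (m <= n)%N -> covers v s n -> covers v s m.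
Proof. by move=> mn cov j jm; apply: cov; apply: leq_trans mn. Qed.

Lemma covers_nseq v n : covers v (nseq n v) n.
Proof.
elim: n => [|n IH] j; first by rewrite leqn0 => /eqP ->; rewrite subsums0.
case: j => [|j]; first by rewrite subsums0.
by rewrite ltnS => /IH vj; rewrite subsums_consE mulrS addrAC subrr add0r vj orbT.
Qed.

(** Each block of [p] copies of [w] moves the interval of multiples of [v] by [q]
steps; as [q <= m + 1], consecutive translates of the interval leave no gap. *)
Lemma covers_cat v w s t m n p q k : covers v s m -> covers w t n ->
  w *+ p = v *+ q -> (q <= m.+1)%N -> (p * k <= n)%N ->
  covers v (s ++ t) (m + q * k).
Proof.
move=> cv cw e le_q le_p j le_j; pose i := minn k (j %/ q).
have iq : (i * q <= j)%N by apply: leq_trans (leq_divM j q); rewrite leq_mul2r geq_minr orbT.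
have le_m : (j - i * q <= m)%N.
  have [q0|q_gt0] := posnP q; first by move: le_j; rewrite q0 muln0 mul0n; lia.
  rewrite /i; case: (leqP k (j %/ q)) => [le_k|lt_k]; first by lia.
  by have := divn_eq j q; have := ltn_pmod j q_gt0; lia.
rewrite -(subnK iq) mulrnDr subsums_cat mem_addfs ?cv // mulnC mulrnA -e -mulrnA.
by apply: cw; apply: leq_trans le_p; rewrite leq_mul2l geq_minl orbT.
Qed.

Lemma covers_nseq_cat v s m n : covers v s m -> covers v (s ++ nseq n v) (m + n).
Proof.
move=> cv; rewrite -[X in covers _ _ (m + X)%N]mul1n.
by apply: (@covers_cat v v s (nseq n v) m n 1 1) => //; [exact: covers_nseq|rewrite mul1n].
Qed.

Lemma zsf_nseq_neq0 n k v : zsf (nseq n v) -> (0 < k <= n)%N -> v *+ k != 0.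
Proof.
move=> z /andP[k_gt0 kn]; have := z (nseq k v) (nseq (n - k) v).
rewrite -nseqD subnKC // => /(_ (perm_refl _)); case: k k_gt0 {kn} => // k _ /(_ isT).
have -> // : \sum_(x <- nseq k.+1 v) x = v *+ k.+1.
by elim: k => [|k IH]; [rewrite big_seq1|rewrite /= big_cons IH -mulrS].
Qed.

(** The relations [w *+ p = v *+ q] excluded here are those that would identify two
of the sums [v *+ i + w *+ j] with [i <= n] and [j <= c]; relations of opposite
signs are excluded by zero-sum-freeness. *)
Definition unrelated c v n w :=
  forall p q, (0 < p <= c)%N -> (0 < q <= n)%N -> w *+ p != v *+ q.

Lemma card_subsums_unrelated s c v n w t : zsf s ->
  (exists r, perm_eq s (t ++ nseq c w ++ r)) -> (exists r, perm_eq s (v :: t ++ r)) ->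
  covers v t n -> unrelated c v n w -> (n.+1 * c.+1 <= #|` subsums (t ++ nseq c w)|)%N.
Proof.
move=> z [r1 p1] [r2 p2] cv un.
have z1 : zsf (t ++ nseq c w) by apply: zsf_sub z; rewrite catA in p1; exact: p1.
have z2 : zsf (v :: t) by apply: (zsf_sub (u := r2)) z.
have zw : zsf (nseq c w) := zsf_catr z1.
have vn0 d : (0 < d <= n)%N -> v *+ d != 0.
  case: d => // d /andP[_ le_d]; rewrite mulrS; apply: (zsf_cons z2); apply: cv.
  exact: ltnW.
pose L := [seq v *+ i + w *+ j | i <- iota 0 n.+1, j <- iota 0 c.+1].
have <- : size L = (n.+1 * c.+1)%N by rewrite size_allpairs !size_iota.
apply: uniq_leq_size; last first.
  move=> x /allpairsP[[i j] []]; rewrite !mem_iota !add0n !ltnS /= => ii jj ->.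
  by rewrite subsums_cat mem_addfs ?cv ?covers_nseq.
have lt_neq i j i' j' : (i <= n)%N -> (i' <= n)%N -> (j <= c)%N -> (j' <= c)%N ->
    (j < j')%N -> v *+ i + w *+ j != v *+ i' + w *+ j'.
  move=> le_i le_i' le_j le_j' lt_j; apply/eqP => e.
  have [lt_i|le_ii] := ltnP i' i.
    have : w *+ (j' - j) != v *+ (i - i') by apply: un; lia.
    rewrite !mulrnBr; [|lia..]; rewrite subr_eq addrAC -subr_eq opprK.
    by rewrite [X in X != _]addrC -e addrC eqxx.
  have e0 : v *+ (i' - i) + w *+ (j' - j) = 0.
    rewrite !mulrnBr; [|lia..]; rewrite addrACA -opprD -e subrr //.
  have [|//|_ /eqP] := zsf_cat z1 _ _ e0.
  - by apply: cv; lia.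
  - by apply: covers_nseq; lia.
  by apply/negP/(zsf_nseq_neq0 zw); lia.
apply: allpairs_uniq; rewrite ?iota_uniq // => -[i j] [i' j'].
move=> /allpairsP[[a b] [ia jb [-> ->]]] /allpairsP[[a' b'] [ia' jb' [-> ->]]].
move: ia jb ia' jb'; rewrite !mem_iota !add0n !ltnS /= => ia jb ia' jb' e.
case: (ltngtP b b') => [lt|lt|bb].
- by have := lt_neq _ _ _ _ ia ia' jb jb' lt; rewrite e eqxx.
- by have := lt_neq _ _ _ _ ia' ia jb' jb lt; rewrite e eqxx.
rewrite bb in e *; move/addIr: e => e; congr (_, _).
wlog lt : a a' ia ia' e / (a < a')%N.
  move=> W; case: (ltngtP a a') => // lt; first exact: W lt.
  by symmetry; apply: W lt.
have : v *+ (a' - a) != 0 by apply: vn0; lia.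
by rewrite mulrnBr ?(ltnW lt) // e subrr eqxx.
Qed.

End Covers.

(** * Classes of terms with a common leader *)

Section Classes.
Variables (R : rcfType) (G : zmodType).
Local Notation class := (G * seq G * nat)%type.
Implicit Types (s t u : seq G) (v w x y : G) (cs ts : seq class) (d e : class).

Definition lead d : G := d.1.1.
Definition mass d : seq G := d.1.2.
Definition len d : nat := d.2.

(** A class consists of a leader [v], of a list [mass] of terms, and of a length [len]
such that the multiples of [v] up to [len] are sums of the mass.  Here [k] counts
the copies of each leader kept in reserve. *)
Definition blocks k cs := flatten [seq nseq k (lead d) ++ mass d | d <- cs].

Lemma blocks_cons k d cs : blocks k (d :: cs) = nseq k (lead d) ++ mass d ++ blocks k cs.
Proof. by rewrite /blocks /= catA. Qed.

Lemma blocks_perm k cs cs' : perm_eq cs cs' -> perm_eq (blocks k cs) (blocks k cs').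
Proof. by move=> p; apply/perm_flatten/perm_map. Qed.

Lemma blocksS k cs : perm_eq (blocks k.+1 cs) (map lead cs ++ blocks k cs).
Proof.
elim: cs => // d cs IH; rewrite !blocks_cons; apply/permP => a.
by have /permP/(_ a) := IH; rewrite /= !count_cat /= ?count_cat; lia.
Qed.

Lemma undup_leads s cs : uniq (map lead cs) -> {subset map lead cs <= s} ->
  exists r, perm_eq (undup s) (map lead cs ++ r).
Proof.
move=> u sub; apply: count_le_perm => x; rewrite !count_uniq_mem ?undup_uniq // mem_undup.
by case: (boolP (x \in map lead cs)) => // /sub ->.
Qed.

(** The copies of the leaders in the support complete their reserves from [k - 1] to
[k] copies. *)
Lemma reserve_leads k s cs t r : (0 < k)%N -> uniq (map lead cs) ->
  {subset map lead cs <= s} -> perm_eq s (undup s ++ t ++ blocks k.-1 cs ++ r) ->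
  exists r', perm_eq s (t ++ blocks k cs ++ r').
Proof.
move=> k_gt0 u sub p; have [r' pr'] := undup_leads u sub; exists (r' ++ r).
apply/permP => a; rewrite (permP p) -[in RHS](prednK k_gt0).
have /permP/(_ a) := blocksS k.-1 cs; have /permP/(_ a) := pr'.
by rewrite !count_cat; lia.
Qed.

Lemma nzsums_uniq_large c s : zsf s -> uniq s -> (36 * c <= size s)%N ->
  (c * size s <= nzsums s)%N.
Proof.
move=> z u le; have [->//|c_gt0] := posnP c.
rewrite -(ler_nat R) natrM; apply: le_trans (nzsums_quadratic R z u); rewrite /qbound.
have := sqr_sqrtn R (size s); have : 0 <= Num.sqrt ((size s)%:R : R) by apply: sqrtr_ge0.
have : 36 * c%:R <= (size s)%:R :> R by rewrite -(natrM _ 36) ler_nat.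
have : 1 <= c%:R :> R by rewrite (ler_nat _ 1).
set y := Num.sqrt _; move: y (size s)%:R c%:R => y x k k1 le_x y0 ye.
have y6 : 6 <= y by nra.
have -> : y ^+ 3 * (y - 4) / 6 = y ^+ 2 * (y * (y - 4) / 6) by ring.
rewrite ye mulrC ler_wpM2l //; nra.
Qed.

Section Contradiction.
Variables (s : seq G) (c m : nat).
Hypotheses (zs : zsf s) (c2 : (2 <= c)%N) (lt_s : (nzsums s < c * m)%N)
  (le_m : (36 * c ^ 3 <= m)%N).

(** Suppose that the short classes are all that is missing, up to [c], to reach the
total [m], and that the rest has [c + 1] sums per unit of length.  If there are
many short classes, their reserves form [c] sets of leaders, which have
enough sums by the quadratic bound.  If there are few, their total length is less
than [36 c ^ 2], and the surplus of one sum per unit of length elsewhere makes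
up for this loss because [m >= 36 c ^ 3]. *)
Lemma short_classes_contra b t ts r : perm_eq s (t ++ blocks c ts ++ r) ->
  uniq (map lead ts) -> (forall d, d \in ts -> (len d + 2 <= c)%N) ->
  (c.+1 * b <= nzsums t)%N -> (m <= b + \sum_(d <- ts) len d + c)%N -> False.
Proof.
move=> p u short le_b le_sum.
have le_short : (\sum_(d <- ts) len d + 2 * size ts <= size ts * c)%N.
  rewrite -sum1_size big_distrr big_distrl -big_split /= big_seq [leqRHS]big_seq.
  by apply: leq_sum => d dts; have := short d dts; lia.
have zt : zsf (t ++ blocks c ts) by apply: zsf_sub zs; rewrite catA in p; exact: p.
have le1 : (nzsums t + nzsums (blocks c ts) <= nzsums s)%N.
  apply: leq_trans (nzsums_cat zt) _; apply: (@nzsums_sub _ s _ r) => //.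
  by rewrite -catA.
have [le_ts|lt_ts] := leqP (36 * c) (size ts).
  have le2 : (c * (c * size ts) <= nzsums (blocks c ts))%N.
    have pb : perm_eq (blocks c ts)
        (flatten (nseq c (map lead ts)) ++ flatten (map mass ts)).
      apply: perm_trans (perm_flatten_cat _ _ _) _; rewrite perm_cat2r.
      apply/permP => a; rewrite !count_flatten map_nseq sumn_nseq count_map -map_comp.
      elim: (ts) => [|d l IH]; first by rewrite mul0n.
      by rewrite /= count_nseq IH mulnDl.
    have zb := zsf_perm pb (zsf_catr zt).
    apply: leq_trans (nzsums_sub pb (zsf_catr zt)).
    apply: leq_trans (nzsums_flatten (zsf_catl zb)).
    rewrite big_nseq iter_addn_0 mulnC leq_mul2r -(size_map lead); apply/orP; right.
    apply: nzsums_uniq_large => //; last by rewrite size_map.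
    have := zsf_catl zb; case: c c2 => // k _ /=; exact: zsf_catl.
  have : (c * m <= c * b + c * (c * size ts))%N by rewrite -mulnDr leq_mul2l; nia.
  by nia.
have le3 : (\sum_(d <- ts) len d + c + 36 * c <= 36 * c * c)%N.
  have : (size ts * (c - 2) <= 36 * c * (c - 2))%N by rewrite leq_mul2r ltnW ?orbT.
  have : (36 * c * 2 <= 36 * c * c)%N by rewrite leq_mul2l c2 orbT.
  by move: le_short; rewrite !mulnBr; lia.
move: le3 le_sum; move: (\sum_(d <- ts) len d)%N => S le3 le_sum.
have le4 : (c.+1 * (S + c) <= m)%N.
  apply: leq_trans le_m; rewrite !expnS expn0 muln1.
  have : (c.+1 * (S + c + 36 * c) <= c.+1 * (36 * c * c))%N by rewrite leq_mul2l le3.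
  by nia.
have : (c.+1 * m <= c.+1 * b + c.+1 * (S + c))%N by rewrite -mulnDr leq_mul2l; lia.
by move: lt_s le1 le_b; lia.
Qed.

End Contradiction.

Lemma zip_shift (T : eqType) (a : T) l b : uniq (a :: l) -> last a l != b ->
  forall p, p \in zip (a :: l) (rcons l b) -> p.1 != p.2 /\ (p.1 \in a :: l).
Proof.
elim: l a => [|a' l IH] a /=.
  by move=> _ ab p; rewrite [p \in _]mem_seq1 => /eqP -> /=; rewrite mem_head.
rewrite inE negb_or -andbA => /and4P[aa' al a'l ul] lb p.
rewrite [p \in _]in_cons => /predU1P[-> /=|pz]; first by rewrite mem_head.
have [] := IH a' _ lb p pz; first by rewrite /= a'l.
by move=> -> pin; split=> //; rewrite in_cons pin orbT.
Qed.

Lemma mem_rcons_shift (T : eqType) (a : T) l b p :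
  p \in zip (a :: l) (rcons l b) -> p.2 \in b :: l.
Proof.
move=> pz; have : p.2 \in rcons l b.
  have -> : rcons l b = unzip2 (zip (a :: l) (rcons l b)) by rewrite unzip2_zip ?size_rcons.
  exact: map_f.
by rewrite mem_rcons.
Qed.

(** Each class is paired with the reserve of the next one in cyclic order, so that
every reserve is used exactly once, next to a class with a different leader. *)
Lemma nzsums_cycle s c d e cs r : zsf s -> (2 <= c)%N ->
  uniq (map lead [:: d, e & cs]) ->
  perm_eq s (blocks c [:: d, e & cs] ++ r) ->
  (forall a, a \in [:: d, e & cs] -> covers (lead a) (mass a) (len a)) ->
  (forall a b, a \in [:: d, e & cs] -> b \in [:: d, e & cs] -> a != b ->
     unrelated c (lead a) (len a) (lead b)) ->
  (c.+1 * \sum_(a <- [:: d, e & cs]) len a <= nzsums (blocks c [:: d, e & cs]))%N.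
Proof.
move=> zs c2; set l := [:: d, e & cs] => ul pl cov un.
pose z := zip l (rcons (e :: cs) d).
pose bl (p : class * class) := mass p.1 ++ nseq c (lead p.2).
have sz : size l = size (rcons (e :: cs) d) by rewrite size_rcons.
have pz : perm_eq (blocks c l) (flatten (map bl z)).
  apply: perm_trans (perm_flatten_cat _ _ _) _; rewrite perm_sym.
  apply: perm_trans (perm_flatten_cat _ _ _) _; rewrite perm_catC.
  have -> : [seq nseq c (lead p.2) | p <- z] = [seq nseq c (lead a) | a <- unzip2 z].
    by rewrite -map_comp.
  have -> : [seq mass p.1 | p <- z] = [seq mass a | a <- unzip1 z] by rewrite -map_comp.
  rewrite unzip1_zip ?sz // unzip2_zip ?sz // perm_cat2r.
  by apply/perm_flatten/perm_map; rewrite perm_rcons.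
have zl : zsf (blocks c l) := zsf_sub pl zs.
rewrite (nzsums_perm pz); apply: leq_trans (nzsums_flatten (zsf_perm pz zl)).
rewrite -[in X in (c.+1 * X <= _)%N](unzip1_zip (s := l) (t := rcons (e :: cs) d)) ?sz //.
rewrite !big_map big_distrr /= big_seq [leqRHS]big_seq; apply: leq_sum => p pin.
have [|ne p1] := zip_shift (map_uniq ul) _ pin.
  apply/eqP => /= last_d; have := map_uniq ul; rewrite cons_uniq => /andP[/negP dN _].
  by apply: dN; rewrite -{1}last_d mem_last.
have p2 : p.2 \in l := @mem_rcons_shift _ d (e :: cs) d p pin.
have pb : perm_eq l (p.1 :: rem p.1 l) by apply: perm_to_rem.
have := @card_subsums_unrelated _ s c (lead p.1) (len p.1) (lead p.2) (mass p.1) zs.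
rewrite subsums_card => /(_ _ _ _ _)/wrap[].
- have pz' := perm_to_rem pin.
  exists (flatten (map bl (rem p z)) ++ r); apply: perm_trans pl _.
  rewrite catA catA perm_cat2r; apply: perm_trans pz _.
  by apply: perm_trans (perm_flatten (perm_map bl pz')) _; rewrite /= -catA.
- exists (nseq c.-1 (lead p.1) ++ blocks c (rem p.1 l) ++ r).
  apply/permP => a; rewrite (permP pl) count_cat (permP (blocks_perm c pb)) blocks_cons.
  have -> : nseq c (lead p.1) = lead p.1 :: nseq c.-1 (lead p.1).
    by rewrite -[in LHS](prednK (ltnW c2)).
  by rewrite /= !count_cat /=; lia.
- exact: cov.
- exact: un.
by move=> le; rewrite -ltnS; apply: leq_trans le; rewrite mulnC ltn_pmul2r.
Qed.

End Classes.

(** * Merging classes around a central element *)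

Section Central.
Variables (R : rcfType) (G : zmodType).
Local Notation class := (G * seq G * nat)%type.
Implicit Types (t u : seq G) (v w x y : G) (cs ts : seq class) (d e : class).
Variables (s : seq G) (c m : nat).

(** One copy of each distinct term is set aside, and each class keeps [c - 1] further
copies of its leader in reserve.  Mergers preserve the total length [m]. *)
Definition system cs :=
  [/\ uniq (map (@lead G) cs), {subset map (@lead G) cs <= s},
      (exists r, perm_eq s (undup s ++ blocks c.-1 cs ++ r)),
      (forall d, d \in cs -> covers (lead d) (mass d) (len d)) &
      (\sum_(d <- cs) len d = m)%N].

Definition central := exists a t r,
  [/\ a \in s, covers a t m & perm_eq s (undup s ++ t ++ r)].

Lemma not_unrelated v n w : ~ unrelated c v n w -> exists p q,
  [/\ (0 < p <= c)%N, (0 < q <= n)%N & w *+ p = v *+ q].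
Proof.
move=> H; apply: contrapT => H'; apply: H => p q pc qn; apply/eqP => e.
by apply: H'; exists p, q.
Qed.

Lemma system_perm cs cs' : perm_eq cs cs' -> system cs -> system cs'.
Proof.
move=> pc [u sub [r pr] cov sum]; split.
- by rewrite -(perm_uniq (perm_map _ pc)).
- by move=> x; rewrite -(perm_mem (perm_map _ pc)); apply: sub.
- exists r; apply: perm_trans pr _; rewrite perm_cat2l perm_cat2r.
  exact: blocks_perm.
- by move=> d; rewrite -(perm_mem pc); apply: cov.
- by rewrite -(perm_big _ pc).
Qed.

(** The reserve of the absorbed class makes up for rounding: its [len e + c - 1] copies
contain enough blocks of [p <= c] to cover [len e]. *)
Lemma system_merge d e cs p q : system [:: d, e & cs] -> (0 < p <= c)%N ->
  (p <= q <= (len d).+1)%N -> lead e *+ p = lead d *+ q ->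
  system ((lead d, mass d ++ (mass e ++ nseq c.-1 (lead e)), len d + len e)%N :: cs).
Proof.
case=> u sub [r pr] cov sum /andP[p_gt0 le_p] /andP[le_pq le_q] eq_pq; split.
- by move: u; rewrite /= inE negb_or -andbA => /and4P[_ -> _ ->].
- move=> x; rewrite /= inE => xin; apply: sub; rewrite /= !inE.
  by case/orP: xin => ->; rewrite ?orbT.
- exists r; apply: perm_trans pr _; rewrite !blocks_cons; apply/permP => a.
  by rewrite /lead /mass /= !count_cat; lia.
- move=> x; rewrite inE => /predU1P[->|xcs]; last by apply: cov; rewrite !inE xcs !orbT.
  have cd : covers (lead d) (mass d) (len d) by apply: cov; rewrite mem_head.
  have ce : covers (lead e) (mass e) (len e) by apply: cov; rewrite !inE eqxx orbT.
  pose k := ((len e + c.-1) %/ p)%N.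
  have kp : (p * k <= len e + c.-1)%N by rewrite mulnC leq_divM.
  have pk : (len e + c.-1 < p * k + p)%N.
    by have := ltn_ceil (len e + c.-1) p_gt0; rewrite -/k mulSn; lia.
  have qk : (p * k <= q * k)%N by rewrite leq_mul2r le_pq orbT.
  have lek : (len e <= q * k)%N by lia.
  apply: (@covers_le _ _ _ _ (len d + q * k)%N); first by rewrite leq_add2l.
  exact: covers_cat cd (covers_nseq_cat (n := c.-1) ce) eq_pq le_q kp.
- by move: sum; rewrite !big_cons /= addnA.
Qed.

Lemma perm_two (T : eqType) (l : seq T) a b : a \in l -> b \in l -> a != b ->
  exists l', perm_eq l [:: a, b & l'].
Proof.
move=> al bl ab; exists (rem b (rem a l)).
apply: perm_trans (perm_to_rem al) _; rewrite perm_cons perm_to_rem //.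
have := perm_mem (perm_to_rem al) b; rewrite bl inE eq_sym (negbTE ab) /= => <- //.
Qed.

Hypotheses (zs : zsf s) (c2 : (2 <= c)%N) (lt_s : (nzsums s < c * m)%N)
  (le_m : (36 * c ^ 3 <= m)%N).

(** The class under construction has no reserve: its reserve is part of its mass, so
that it covers [c - 1] more than its nominal length [b].  If a short class is
unrelated to it, the two together have too many sums.  A relation
[w *+ i = v *+ j] lets it absorb the short class when [i <= j], and otherwise be
absorbed, the leader of the short class taking over; the margin [c - 1] makes up
for rounding in both cases. *)
Lemma absorb_short ts v t b n r : v \in s -> covers v t n -> (b + c.-1 <= n)%N ->
  perm_eq s (undup s ++ t ++ blocks c.-1 ts ++ r) ->
  uniq (map (@lead G) ts) -> {subset map (@lead G) ts <= s} ->
  (forall d, d \in ts -> covers (lead d) (mass d) (len d)) ->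
  (forall d, d \in ts -> (len d + 2 <= c)%N) ->
  (b + \sum_(d <- ts) len d = m)%N -> central.
Proof.
elim: ts v t b n r => [|d ts IH] v t b n r vs cv le_n p u sub cov short sum.
  exists v, t, r; split=> //; apply: covers_le cv.
  by move: sum; rewrite big_nil; lia.
have c_gt0 : (0 < c)%N by lia.
have ds : lead d \in s by apply: sub; rewrite /= mem_head.
have ds2 := short d (mem_head _ _).
have u' : uniq (map (@lead G) ts) by case/andP: u.
have sub' : {subset map (@lead G) ts <= s}.
  by move=> x xts; apply: sub; rewrite /= inE xts orbT.
have cov' e : e \in ts -> covers (lead e) (mass e) (len e).
  by move=> ets; apply: cov; rewrite inE ets orbT.
have short' e : e \in ts -> (len e + 2 <= c)%N.
  by move=> ets; apply: short; rewrite inE ets orbT.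
rewrite big_cons in sum.
have cd := covers_nseq_cat (n := c.-1) (cov d (mem_head _ _)).
have [un|/not_unrelated[i [j [/andP[i_gt0 le_i] /andP[j_gt0 le_j] e]]]] :=
    pselect (unrelated c v n (lead d)).
  exfalso; have [r' pr'] := reserve_leads c_gt0 u sub p.
  apply: (@short_classes_contra R G s c m zs c2 lt_s le_m b (t ++ nseq c (lead d)) ts
    (mass d ++ r')) => //; last by lia.
    apply: perm_trans pr' _; rewrite blocks_cons; apply/permP => a.
    by rewrite !count_cat; lia.
  have := @card_subsums_unrelated _ s c v n (lead d) t zs; rewrite subsums_card.
  move=> /(_ _ _ cv un)/wrap[].
  - exists (mass d ++ blocks c ts ++ r'); apply: perm_trans pr' _; rewrite blocks_cons.
    by apply/permP => a; rewrite !count_cat; lia.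
  - exists (rem v (undup s) ++ blocks c.-1 (d :: ts) ++ r); apply: perm_trans p _.
    have pv : perm_eq (undup s) (v :: rem v (undup s)) by rewrite perm_to_rem ?mem_undup.
    by apply/permP => a; rewrite !count_cat (permP pv) /= !count_cat; lia.
  move=> le; rewrite -ltnS; apply: leq_trans le.
  by rewrite mulnC ltn_pmul2r // ltnS; lia.
have perm' : perm_eq s (undup s ++ (t ++ mass d ++ nseq c.-1 (lead d)) ++
    blocks c.-1 ts ++ r).
  apply: perm_trans p _; rewrite blocks_cons; apply/permP => a.
  by rewrite !count_cat; lia.
have [le_ij|lt_ji] := leqP i j.
  pose k := ((len d + c.-1) %/ i)%N.
  have ki : (i * k <= len d + c.-1)%N by rewrite mulnC leq_divM.
  have ik : (len d + c.-1 < i * k + i)%N.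
    by have := ltn_ceil (len d + c.-1) i_gt0; rewrite -/k mulSn; lia.
  have jk : (i * k <= j * k)%N by rewrite leq_mul2r le_ij orbT.
  apply: (IH v (t ++ mass d ++ nseq c.-1 (lead d)) (b + len d)%N (n + j * k)%N r) => //.
  - by apply: covers_cat cv cd e _ ki; apply: leq_trans le_j _.
  - by lia.
  - by lia.
pose k := (n %/ j)%N.
have kj : (j * k <= n)%N by rewrite mulnC leq_divM.
have jk : (n < j * k + j)%N.
  by have := ltn_ceil n j_gt0; rewrite -/k mulSn; lia.
have k_gt0 : (0 < k)%N by rewrite divn_gt0.
have ijk : (j.+1 * k <= i * k)%N by rewrite leq_mul2r lt_ji orbT.
rewrite mulSn in ijk.
apply: (IH (lead d) ((mass d ++ nseq c.-1 (lead d)) ++ t) (b + len d)%N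
  (len d + c.-1 + i * k)%N r) => //.
- by apply: covers_cat cd cv (esym e) _ kj; lia.
- by lia.
- by apply: perm_trans perm' _; apply/permP => a; rewrite !count_cat; lia.
- by lia.
Qed.

(** Merge as long as possible.  A relation between two leaders then allows no merger
only because the class that ought to absorb the other has length less than
[c - 1]; so classes of length at least [c - 1] are pairwise
unrelated.  With no such class, or with at least two of them, there are too many
sums; a unique one absorbs the others. *)
Lemma system_central cs : system cs -> central.
Proof.
have [n] := ubnP (size cs); elim: n cs => // n IH cs; rewrite ltnS => le_n sys.
have [[d [e [l [pl [p [q [pc qd epq]]]]]]]|nomerge] := pselect (exists d e l,
    perm_eq cs [:: d, e & l] /\ exists p q,
    [/\ (0 < p <= c)%N, (p <= q <= (len d).+1)%N & lead e *+ p = lead d *+ q]).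
  apply: (IH _ _ (system_merge (system_perm pl sys) pc qd epq)).
  by move: le_n; rewrite (perm_size pl).
have un d e : d \in cs -> e \in cs -> d != e -> (c <= len e + 1)%N ->
    unrelated c (lead d) (len d) (lead e).
  move=> dcs ecs de long p q /andP[p_gt0 le_p] /andP[q_gt0 le_q]; apply/eqP => epq.
  apply: nomerge; have [le_pq|lt_qp] := leqP p q.
    have [l pl] := perm_two dcs ecs de; exists d, e, l; split=> //; exists p, q.
    by split=> //; lia.
  have [|l pl] := perm_two ecs dcs _; first by rewrite eq_sym.
  by exists e, d, l; split=> //; exists q, p; split=> //; lia.
pose long d := (c <= len d + 1)%N.
have pcs : perm_eq cs ([seq d <- cs | long d] ++ [seq d <- cs | ~~ long d]).
  by rewrite perm_sym perm_filterC.
have short d : d \in [seq d <- cs | ~~ long d] -> (len d + 2 <= c)%N.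
  by rewrite mem_filter /long => /andP[]; lia.
have long_cs d : d \in [seq d <- cs | long d] -> long d /\ d \in cs.
  by rewrite mem_filter => /andP[].
move: (system_perm pcs sys) short long_cs.
move: [seq d <- cs | long d] [seq d <- cs | ~~ long d] => bs ts [u sub [r pr] cov sum].
move=> short long_cs; rewrite map_cat cat_uniq in u; case/and3P: u => ub nbt ut.
have subt : {subset map (@lead G) ts <= s}.
  by move=> x xts; apply: sub; rewrite map_cat mem_cat xts orbT.
have subb : {subset map (@lead G) bs <= s}.
  by move=> x xbs; apply: sub; rewrite map_cat mem_cat xbs.
have c_gt0 : (0 < c)%N by lia.
have u : uniq (map (@lead G) (bs ++ ts)) by rewrite map_cat cat_uniq ub nbt.
have [r' pr'] := @reserve_leads _ c s (bs ++ ts) [::] r c_gt0 u sub pr.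
have pr2 : perm_eq s (blocks c bs ++ blocks c ts ++ r').
  by rewrite /blocks map_cat flatten_cat -catA in pr'; apply: pr'.
rewrite big_cat /= in sum.
case: bs {nbt u pr'} ub subb long_cs pr pr2 cov sum {sub} =>
  [|d [|e bs]] ub subb long_cs pr pr2 cov sum.
- exfalso; apply: (@short_classes_contra R G s c m zs c2 lt_s le_m 0 [::] ts r') => //.
    by rewrite muln0.
  by rewrite -sum big_nil add0n leq_addr.
- have ds : lead d \in s by apply: subb; rewrite /= mem_head.
  apply: (@absorb_short ts (lead d) (mass d ++ nseq c.-1 (lead d)) (len d)
    (len d + c.-1) r) => //.
  + by apply/covers_nseq_cat/cov; rewrite mem_head.
  + apply: perm_trans pr _; rewrite cat_cons cat0s blocks_cons; apply/permP => a.
    by rewrite !count_cat; lia.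
  + by move=> e ets; apply: cov; rewrite mem_cat ets orbT.
  + by rewrite -sum big_seq1.
exfalso; apply: (@short_classes_contra R G s c m zs c2 lt_s le_m
  (\sum_(a <- [:: d, e & bs]) len a) (blocks c [:: d, e & bs]) ts r') => //.
  apply: (nzsums_cycle zs c2 ub pr2).
    by move=> a ain; apply: cov; rewrite mem_cat ain.
  move=> a b ain bin ab; apply: un => //; first by case: (long_cs _ ain).
    by case: (long_cs _ bin).
  by case: (long_cs _ bin).
by rewrite sum leq_addr.
Qed.

End Central.

(** * Initial classes and the covering set *)

Section Initial.
Variable G : zmodType.
Implicit Types (s t : seq G).

Lemma initial_system s c m : (0 < c)%N ->
  m = (\sum_(x <- undup s) (count_mem x s - c))%N -> exists cs, system s c m cs.
Proof.
move=> c_gt0 mE; pose r := [seq x <- undup s | (c < count_mem x s)%N].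
pose k x := (count_mem x s - c)%N; pose F x := (x, nseq (k x) x, k x).
exists (map F r); have leads : map (@lead G) (map F r) = r.
  by rewrite -map_comp (eq_map (g := id)) ?map_id.
have ur : uniq r by rewrite filter_uniq ?undup_uniq.
split.
- by rewrite leads.
- by move=> x; rewrite leads mem_filter mem_undup => /andP[].
- have [|u pu] := @count_le_perm _ s (undup s ++ blocks c.-1 (map F r)).
    move=> y; rewrite count_cat /blocks -map_comp.
    rewrite (@count_flatten_uniq _ _ (fun x => c.-1 + k x)%N) //; last first.
      move=> x z; rewrite /= count_cat !count_mem_nseq /lead /mass /=.
      by case: eqP.
    rewrite count_uniq_mem ?undup_uniq // mem_undup mem_filter mem_undup /k.
    have [ys|] := boolP (y \in s); last by rewrite andbF.
    rewrite andbT; case: ltnP => /=; last by rewrite addn0 -has_pred1 has_count in ys *.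
    by lia.
  by exists u; rewrite catA.
- by move=> d /mapP[x _ ->]; apply: covers_nseq.
rewrite big_map mE big_filter big_mkcond /=; apply: eq_bigr => x _.
by rewrite /len /=; case: ltnP => //; rewrite /k; lia.
Qed.

(** Ruzsa's covering argument: [X] is a maximal set of elements of [l], containing 0,
whose translates of the progression [{a, ..., h a}] are disjoint. *)
Lemma subprogression_cover (a : G) h (l : seq G) : exists X : {fset G},
  [/\ {subset X <= 0 :: l}, 0 \in X,
      forall x y i j, x \in X -> y \in X -> (0 < i <= h)%N -> (0 < j <= h)%N ->
        x + a *+ i = y + a *+ j -> x = y &
      (0 < h)%N -> forall y, y \in l -> exists x i j,
        [/\ x \in X, (0 < i <= h)%N, (0 < j <= h)%N & y + a *+ i = x + a *+ j]].
Proof.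
elim: l => [|z l [X [subX X0 sepX covX]]].
  exists [fset 0]%fset; split=> //; try by rewrite inE.
    by move=> x; rewrite !inE.
  by move=> x y i j; rewrite !inE => /eqP -> /eqP ->.
have subX' : {subset X <= 0 :: z :: l}.
  by move=> x /subX; rewrite !inE => /orP[->//|->]; rewrite !orbT.
have [[x [i [j [xX ih jh e]]]]|far] := pselect (exists x i j,
    [/\ x \in X, (0 < i <= h)%N, (0 < j <= h)%N & z + a *+ i = x + a *+ j]).
  exists X; split=> // h0 y; rewrite inE => /predU1P[->|/covX//]; last exact.
  by exists x, i, j.
exists (z |` X)%fset; split.
- by move=> x; rewrite in_fset1U => /predU1P[->|/subX'//]; rewrite !inE eqxx orbT.
- by rewrite in_fset1U X0 orbT.
- move=> x y i j; rewrite !in_fset1U => /predU1P[->|xX] /predU1P[->|yX] ih jh e //.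
  + by case: far; exists y, i, j.
  + by case: far; exists x, j, i.
  + exact: sepX e.
move=> h0 y; rewrite inE => /predU1P[->|yl].
  by exists z, 1%N, 1%N; rewrite in_fset1U eqxx h0.
have [x [i [j [xX ih jh e]]]] := covX h0 y yl.
by exists x, i, j; rewrite in_fset1U xX orbT.
Qed.

Lemma separated_card s (X : {fset G}) a h : (forall k, (0 < k < h)%N -> a *+ k != 0) ->
  (forall x y i j, x \in X -> y \in X -> (0 < i <= h)%N -> (0 < j <= h)%N ->
        x + a *+ i = y + a *+ j -> x = y) ->
  (forall x i, x \in X -> (0 < i <= h)%N -> x + a *+ i \in subsums s) ->
  (#|` X| * h <= #|` subsums s|)%N.
Proof.
move=> a0 sepX sub; pose L := [seq x + a *+ i | x <- enum_fset X, i <- iota 1 h].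
have <- : size L = (#|` X| * h)%N by rewrite size_allpairs size_iota.
apply: uniq_leq_size; last first.
  move=> y /allpairsP[[x i] [xX ih ->]]; apply: sub => //.
  by move: ih; rewrite mem_iota add1n ltnS.
apply: allpairs_uniq; rewrite ?fset_uniq ?iota_uniq // => -[x i] [y j].
move=> /allpairsP[[x' i'] [xX ih [-> ->]]] /allpairsP[[y' j'] [yX jh [-> ->]]].
move: ih jh; rewrite !mem_iota !add1n !ltnS /= in xX yX * => ih jh e.
have xy := sepX _ _ _ _ xX yX ih jh e; rewrite xy in e *; move/addrI: e => e.
congr (_, _); wlog lt : i' j' ih jh e / (i' < j')%N.
  by move=> W; case: (ltngtP i' j') => // lt; [apply: W lt|symmetry; apply: W lt].
have : a *+ (j' - i') != 0 by apply: a0; lia.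
by rewrite mulrnBr ?(ltnW lt) // e subrr eqxx.
Qed.

End Initial.

(** * From multisets to lists *)

Section Bridge.
Local Open Scope mset_scope.
Local Open Scope ring_scope.
Variable G : zmodType.
Implicit Types alpha : {mset G}.

Lemma SigmaxP alpha y : Sigmax alpha y <->
  exists t u, [/\ perm_eq alpha (t ++ u), t != [::] & y = \sum_(x <- t) x].
Proof.
split=> [[beta [ba b0] <-]|[t [u [p t0 ->]]]].
  have [|u pu] := @count_le_perm _ alpha beta.
    by move=> x; rewrite !count_mem_mset; apply/msubsetP.
  exists beta, u; split=> //; apply: contra_notN b0 => /eqP b0.
  by apply/msetP => x; rewrite -count_mem_mset b0 mset0E.
exists (seq_mset t); last by apply: perm_big; apply: perm_eq_seq_mset.
split.
  apply/msubsetP => x; rewrite mset_seqE -count_mem_mset (permP p) count_cat leq_addr //.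
move=> e; have := perm_eq_seq_mset t; rewrite e enum_mset0 => /perm_size/esym/size0nil t0'.
by rewrite t0' in t0.
Qed.

Lemma SigmaP alpha y : Sigma alpha y <-> y \in subsums alpha.
Proof.
split=> [[beta ba <-]|/subsumsP[t [u [p ->]]]].
  have [|u pu] := @count_le_perm _ alpha beta.
    by move=> x; rewrite !count_mem_mset; apply/msubsetP.
  by apply/subsumsP; exists beta, u.
exists (seq_mset t); last by apply: perm_big; apply: perm_eq_seq_mset.
by apply/msubsetP => x; rewrite mset_seqE -count_mem_mset (permP p) count_cat leq_addr.
Qed.

Lemma zero_sum_free_zsf alpha : zero_sum_free alpha -> zsf alpha.
Proof.
move=> z t u p t0; apply/eqP => e; apply: z; apply/SigmaxP.
by exists t, u.
Qed.

Lemma card_Sigma alpha : #|` fset_set (Sigma alpha)|%fset = #|` subsums alpha|%fset.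
Proof.
have -> : Sigma alpha = [set` subsums alpha]%classic.
  by apply/seteqP; split=> y /SigmaP.
by rewrite set_fsetK.
Qed.

Lemma supp_msetP alpha y : Sigma (supp_mset alpha) y <-> y \in subsums (undup alpha).
Proof.
have p : perm_eq (supp_mset alpha) (undup alpha).
  by rewrite (perm_trans (perm_eq_seq_mset _)) // perm_sym perm_undup_mset.
by rewrite -(subsums_perm p); apply: SigmaP.
Qed.

End Bridge.

Local Open Scope mset_scope.
Local Open Scope classical_set_scope.
Local Open Scope ring_scope.

Theorem theorem1 (R : realType) (G : zmodType) (C n : nat) (alpha : {mset G})
    (hC : (2 <= C)%N)
    (hzsf : zero_sum_free alpha)
    (hn : n = size alpha)
    (hnC : ((4 * C) ^ 3 <= n)%N)
    (hSigma : (#|` fset_set (Sigma alpha)|%:R : R)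
              < C%:R * n%:R - C%:R ^+ 2 * Num.sqrt (6%:R * n%:R)) :
  exists (h : nat) (a : G),
    [/\ n%:R - C%:R * Num.sqrt (6%:R * n%:R) < (h%:R : R),
        a \in finsupp alpha,
        ord_gt (ord a) (h + 1),
        sumset (Sigma (supp_mset alpha)) (progression a h) `<=` Sigmax alpha
      & exists X : {fset G},
          [/\ [set` X] `<=` Sigma (supp_mset alpha),
              0 \in X,
              (#|` X| <= C - 1)%N,
              Sigma (supp_mset alpha) `<=`
                diffset (sumset [set` X] (progression a h)) (progression a h)
            & forall g : G, g \in alpha ->
                exists (x : G) (t : int),
                  [/\ x \in X, - (h%:Z - 1) <= t <= h%:Z - 1
                    & g = x + a *~ t]]].
Proof.
have zs := zero_sum_free_zsf hzsf.
rewrite card_Sigma in hSigma.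
pose m := (\sum_(x <- undup alpha) (count_mem x alpha - C))%N.
have [lt_m lt_nz le_m] := overflow_bounds zs hC hn hnC (erefl m) hSigma.
have [cs sys] := initial_system (ltnW hC) (erefl m).
have [a [t [r [a_alpha cov p]]]] := system_central R zs hC lt_nz le_m sys.
have m_gt0 : (0 < m)%N by apply: leq_trans le_m; rewrite muln_gt0 expn_gt0 (ltnW hC).
have a0 k : (0 < k <= m.+1)%N -> a *+ k != 0.
  case: k => // k /andP[_ le_k]; rewrite mulrS.
  apply: (@zsf_cons _ _ t); last exact: cov.
  have pu : perm_eq (undup alpha) (a :: rem a (undup alpha)).
    by rewrite perm_to_rem // mem_undup.
  apply: (zsf_sub (u := rem a (undup alpha) ++ r)) zs; apply: perm_trans p _.
  by apply/permP => b; rewrite !count_cat (permP pu) /= ?count_cat; lia.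
have sums y i : y \in subsums (undup alpha) -> (0 < i <= m)%N -> Sigmax alpha (y + a *+ i).
  move=> /subsumsP[t1 [u1 [p1 ->]]] /andP[i_gt0 le_i]; apply/SigmaxP.
  have /subsumsP[t2 [u2 [p2 e2]]] := cov i le_i.
  exists (t1 ++ t2), (u1 ++ u2 ++ r); split; last by rewrite big_cat /= e2.
    apply: perm_trans p _; apply/permP => b; rewrite !count_cat (permP p1) (permP p2).
    by rewrite !count_cat; lia.
  rewrite -size_eq0 size_cat addn_eq0 negb_and; apply/orP; right.
  rewrite size_eq0; apply/eqP => t20; have := a0 i; rewrite e2 t20 big_nil eqxx.
  by rewrite i_gt0 leqW // => /(_ isT).
exists m, a; split=> //.
- by rewrite msuppE.
- rewrite /ord; case: pselect => //= ex; case: ex_minnP => k /andP[k_gt0 ak0] _.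
  rewrite ltnNge; apply/negP => le_k; have := a0 k; rewrite ak0 k_gt0 /=.
  by rewrite -addn1 le_k => /(_ isT).
- by move=> _ [y /supp_msetP ys [_ [i /= im <-] <-]]; apply: sums.
have [X [subX X0 sepX covX]] :=
  subprogression_cover a m (enum_fset (subsums (undup alpha))).
have subX' x : x \in X -> x \in subsums (undup alpha).
  by move=> /subX; rewrite inE => /predU1P[->|//]; apply: subsums0.
have coverP y : y \in subsums (undup alpha) -> exists x i j,
    [/\ x \in X, (0 < i <= m)%N, (0 < j <= m)%N & y + a *+ i = x + a *+ j].
  exact: covX.
exists X; split=> //.
- by move=> x /subX' xs; apply/supp_msetP.
- have le_X : (#|` X| * m <= #|` subsums alpha|)%N.
    apply: (separated_card (a := a)) sepX _.
      by move=> k /andP[k0 km]; apply: a0; lia.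
    move=> x i /subX' xs im; apply/subsumsP; have /SigmaxP[t' [u [p' _ e]]] := sums x i xs im.
    by exists t', u.
  rewrite leqNgt; apply/negP => lt_X.
  have le_C : (C * m <= #|` X| * m)%N by rewrite leq_mul2r; lia.
  have le_R : C%:R * m%:R <= (#|` subsums alpha|)%:R :> R.
    by rewrite -natrM ler_nat (leq_trans le_C).
  have : C%:R * (n%:R - C%:R * Num.sqrt (6 * n%:R)) < C%:R * m%:R :> R.
    by rewrite ltr_pM2l // ltr0n; lia.
  by move: hSigma le_R; lra.
- move=> y /supp_msetP/coverP[x [i [j [xX im jm e]]]].
  exists (x + a *+ j); last first.
    by exists (a *+ i); [exists i|rewrite -e addrK].
  by exists x => //; exists (a *+ j) => //; exists j.
move=> g g_alpha; have gs : g \in subsums (undup alpha).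
  apply/subsumsP; exists [:: g], (rem g (undup alpha)).
  by rewrite big_seq1 perm_to_rem // mem_undup.
have [x [i [j [xX im jm e]]]] := coverP g gs.
exists x, (j%:Z - i%:Z); split=> //; first by lia.
by rewrite mulrzBr -!pmulrn addrA -e addrK.
Qed.
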